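(* Consider lattice Yang–Mills theory with gauge group $U(N)$ ($N\ge1$) on a finite graph $\Lambda$ with inverse temperature $\beta>0$, and write $\phi(s)=\langle W_s\rangle_{\Lambda,\beta}$. Let $s=(\ell_1,\dots,\ell_n)$ be a string and let $(i,j)$ be a location in $s$. Then $$\phi(s)=-\sum_{s'\in\mathbb S_+((i,j),s)}\phi(s')+\sum_{s'\in\mathbb S_-((i,j),s)}\phi(s')-\frac1{N^2}\sum_{s'\in\mathbb M_+^U((i,j),s)}\phi(s')+\frac1{N^2}\sum_{s'\in\mathbb M_-^U((i,j),s)}\phi(s')-\beta\sum_{s'\in\mathbb D_+((i,j),s)}\phi(s')+\beta\sum_{s'\in\mathbb D_-((i,j),s)}\phi(s').$$
   Context: Lattice Yang–Mills: $\Lambda$ is a finite graph, $E_\Lambda^+$ contains one orientation of each edge. To each $e\in E_\Lambda^+$ is assigned $Q_e\in U(N)$, with $Q_{e^{-1}}=Q_e^{-1}$; for a path $p=(e_1,\dots,e_k)$, $Q_p=Q_{e_1}\cdots Q_{e_k}$. A loop is a directed closed path up to cyclic reordering. $\mathcal P$ is a finite set of loops (plaquettes) closed under orientation reversal (usually directed unit squares). The Yang–Mills measure is $Z^{-1}\prod_{p\in\mathcal P}\exp(N\beta\,\mathrm{Tr}(Q_p))\prod_{e\in E_\Lambda^+}dQ_e$, $dQ_e$ normalized Haar measure. A string is a finite collection of loops $s=(\ell_1,\dots,\ell_n)$; $W_s(Q)=\prod_{i}\frac1N\mathrm{Tr}(Q_{\ell_i})$, and $\langle W_s\rangle_{\Lambda,\beta}$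 is its expectation. The empty (null) loop has $\frac1N\mathrm{Tr}=1$. Fix for each loop a starting point, so loops are words in the oriented edges; location $(i,j)$ is the $j$-th edge of $\ell_i$. Let $e$ be the oriented edge at location $(i,j)$. The following are indexed families (counted with multiplicity, one member for each indicated choice); unchanged loops of $s$ are kept; words with capital letters denote sub-paths, possibly empty. $\mathbb S_+((i,j),s)$: for each other location $(i,k)$, $k\ne j$, of $\ell_i$ at which the edge is also $e$, write $\ell_i=AeBeC$ (the two displayed $e$'s being at the two locations) and replace $\ell_i$ by the two loops $AeC$ and $Be$. $\mathbb S_-((i,j),s)$: for each location $(i,k)$ of $\ell_i$ at which the edge is $e^{-1}$, write $\ell_i=AeBe^{-1}C$ or $\ell_i=Ae^{-1}BeC$ and replace $\ell_i$ by the two loops $AC$ and $B$. $\mathbb M_+^U((i,j),s)$: for each location $(r,m)$ with $r\ne i$ at which the edge is $e$, write $\ell_i=AeB$, $\ell_r=CeD$ and replace $\ell_i,\ell_r$ by the single loop $AeDCeB$. $\mathbb M_-^U((i,j),s)$: for each location $(r,m)$ with $r\ne i$ at which the edge is $e^{-1}$, write $\ell_i=AeB$, $\ell_r=Ce^{-1}D$ and replace $\ell_i,\ell_r$ by the single loop $ADCB$. $\mathbb D_+((i,j),s)$ (positive deformations): for each plaquette $p\in\mathcal P$ and each occurrence of $e$ in $p$, write $\ell_i=AeB$, $p=CeD$ and replace $\ell_i$ by $AeDCeB$. $\mathbb D_-((i,j),s)$ (negative deformations): for each plaquette $p\in\mathcal P$ and each occurrence of $e^{-1}$ in $p$, write $\ell_i=AeB$,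 $p=Ce^{-1}D$ and replace $\ell_i$ by $ADCB$. *)

(* Defs.v *)
From HB Require Import structures.
From mathcomp Require Import all_boot all_order all_algebra.
From mathcomp Require Import complex.
From mathcomp Require Import all_classical all_reals all_analysis.

Set Implicit Arguments.
Unset Strict Implicit.
Unset Printing Implicit Defensive.
Import Order.TTheory GRing.Theory Num.Theory.
Import numFieldNormedType.Exports.

Local Open Scope classical_set_scope.
Local Open Scope ring_scope.
Local Open Scope complex_scope.

(* A finite graph given by its vertices and the chosen orientation [E+] of its
   edges.  An oriented edge is a pair: [(e, true)] is [e], and [(e, false)] is
   its reverse. *)
Record graph := Graph {
  vertex : finType;
  pos_edge : finType;
  pos_src : pos_edge -> vertex;
  pos_tgt : pos_edge -> vertex }.

Section Loops.
Variable L : graph.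

Definition oedge : Type := (pos_edge L * bool)%type.
HB.instance Definition _ := Finite.on oedge.

Implicit Types (x e : oedge) (w p q : seq oedge) (s : seq (seq oedge)).

Definition einv x : oedge := (x.1, ~~ x.2).
Definition src x : vertex L := if x.2 then pos_src x.1 else pos_tgt x.1.
Definition tgt x : vertex L := src (einv x).

(* Loops carry a starting point, as closed words; the empty word is the null
   loop. *)
Definition is_loop w : bool := cycle [rel x y | tgt x == src y] w.
Definition same_loop p q : bool := [exists k : 'I_(size p).+1, rot k p == q].
Definition reverse w : seq oedge := rev (map einv w).

Definition plaquette_set (P : seq (seq oedge)) : Prop :=
  [/\ all is_loop P,
      pairwise (fun p q => ~~ same_loop p q) P
    & forall p, p \in P -> exists2 q, q \in P & same_loop (reverse p) q].

(* Locations are counted from 0. *)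
Definition loop_at s i : seq oedge := nth [::] s i.
Definition edge_at s i j : option oedge := onth (loop_at s i) j.

Definition positions x w : seq nat :=
  [seq k <- iota 0 (size w) | onth w k == Some x].

Definition before k w : seq oedge := take k w.
Definition after k w : seq oedge := drop k.+1 w.
Definition between k m w : seq oedge := drop k.+1 (take m w).

Definition replace s i (new : seq (seq oedge)) : seq (seq oedge) :=
  take i s ++ new ++ drop i.+1 s.
Definition replace2 s i r w : seq (seq oedge) :=
  [seq if a == i then w else loop_at s a | a <- iota 0 (size s) & a != r].

(* In each of the families below [e] stands for the edge at location [(i, j)]
   of [s].  They are sequences, so members are counted with multiplicity. *)

(* A e B e C  ~>  A e C, B e *)
Definition split_pos e s i j : seq (seq (seq oedge)) :=
  let l := loop_at s i in
  [seq let a := minn j k in let b := maxn j k in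
       replace s i [:: before a l ++ e :: after b l; rcons (between a b l) e]
  | k <- positions e l & k != j].

(* A e B e^-1 C or A e^-1 B e C  ~>  A C, B *)
Definition split_neg e s i j : seq (seq (seq oedge)) :=
  let l := loop_at s i in
  [seq let a := minn j k in let b := maxn j k in
       replace s i [:: before a l ++ after b l; between a b l]
  | k <- positions (einv e) l].

(* A e B, C e D  ~>  A e D C e B *)
Definition merge_pos e s i j : seq (seq (seq oedge)) :=
  let l := loop_at s i in
  [seq let l' := loop_at s r in
       replace2 s i r
         (before j l ++ e :: after m l' ++ before m l' ++ e :: after j l)
  | r <- [seq r <- iota 0 (size s) | r != i], m <- positions e (loop_at s r)].

(* A e B, C e^-1 D  ~>  A D C B *)
Definition merge_neg e s i j : seq (seq (seq oedge)) :=
  let l := loop_at s i in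
  [seq let l' := loop_at s r in
       replace2 s i r (before j l ++ after m l' ++ before m l' ++ after j l)
  | r <- [seq r <- iota 0 (size s) | r != i],
    m <- positions (einv e) (loop_at s r)].

(* A e B, p = C e D  ~>  A e D C e B *)
Definition deform_pos (P : seq (seq oedge)) e s i j : seq (seq (seq oedge)) :=
  let l := loop_at s i in
  [seq replace s i
         [:: before j l ++ e :: after m p ++ before m p ++ e :: after j l]
  | p <- P, m <- positions e p].

(* A e B, p = C e^-1 D  ~>  A D C B *)
Definition deform_neg (P : seq (seq oedge)) e s i j : seq (seq (seq oedge)) :=
  let l := loop_at s i in
  [seq replace s i [:: before j l ++ after m p ++ before m p ++ after j l]
  | p <- P, m <- positions (einv e) p].

End Loops.

(* The topology of R[i] as a numeric field: balls for the complex modulus. *)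
HB.instance Definition _ (R : realType) :=
  PseudoPointedMetric.copy R[i] (R[i])^o.

Section UnitaryGroup.
Variables (R : realType) (N : nat).

(* U(N) with the topology induced by that of the N x N complex matrices. *)
Definition unitary_set : set 'M[R[i]]_N := [set g | g \is unitarymx].
Definition unitary : Type := set_type unitary_set.
HB.instance Definition _ := Topological.on unitary.

Definition umx (g : unitary) : 'M[R[i]]_N := set_val g.

Lemma unitary1_subproof : (1%:M : 'M[R[i]]_N) \in unitary_set.
Proof. by rewrite inE; apply/unitarymxP; rewrite trmx1 map_mx1 mulmx1. Qed.

Lemma unitaryM_subproof (g h : unitary) : umx g *m umx h \in unitary_set.
Proof.
by apply/mem_set/mul_unitarymx; [exact: set_mem (valP g)|exact: set_mem (valP h)].
Qed.

Definition umul (g h : unitary) : unitary := SigSub (unitaryM_subproof g h).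

HB.instance Definition _ := isPointed.Build unitary (SigSub unitary1_subproof).

Definition borel_unitary := g_sigma_algebraType (@open unitary).

Definition is_haar (mu : probability borel_unitary R) : Prop :=
  forall (g : unitary) (A : set borel_unitary),
    measurable A -> mu (umul g @` A) = mu A.

End UnitaryGroup.

Section YangMills.
Variables (R : realType) (N : nat) (L : graph).

Definition config_fun : Type := pos_edge L -> borel_unitary R N.
HB.instance Definition _ := Pointed.on config_fun.

(* Configurations [Q], with the product sigma-algebra. *)
Definition config := g_sigma_algebraType
  [set B : set config_fun | exists (e : pos_edge L) (A : set (borel_unitary R N)),
     measurable A /\ B = [set Q | A (Q e)]].

(* [nu] is the product of copies of [mu] indexed by [E+]. *)
Definition is_product_measure (mu : probability (borel_unitary R N) R)
    (nu : probability config R) : Prop :=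
  forall A : pos_edge L -> set (borel_unitary R N),
    (forall e, measurable (A e)) ->
    nu [set Q | forall e, A e (Q e)] = (\prod_(e : pos_edge L) mu (A e))%E.

Definition edge_mx (Q : config) (x : oedge L) : 'M[R[i]]_N :=
  if x.2 then umx (Q x.1) else invmx (umx (Q x.1)).

Definition path_mx (Q : config) (w : seq (oedge L)) : 'M[R[i]]_N :=
  \big[mulmx/1%:M]_(x <- w) edge_mx Q x.

Definition wilson (s : seq (seq (oedge L))) (Q : config) : R[i] :=
  \prod_(l <- s) (N%:R^-1 * \tr (path_mx Q l)).

Definition cexp (z : R[i]) : R[i] :=
  (expR (complex.Re z) * cos (complex.Im z))
    +i* (expR (complex.Re z) * sin (complex.Im z)).

Definition cintegral (nu : probability config R) (f : config -> R[i]) : R[i] :=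
  (\int[nu]_Q complex.Re (f Q)) +i* (\int[nu]_Q complex.Im (f Q)).

(* Real and positive when [P] is closed under reversal, because then the
   imaginary parts of the traces cancel. *)
Definition density (beta : R) (P : seq (seq (oedge L))) (Q : config) : R[i] :=
  \prod_(p <- P) cexp (N%:R * beta%:C * \tr (path_mx Q p)).

(* Expectation of W_s under Z^-1 * prod_p exp(N beta Tr Q_p) * nu. *)
Definition wilson_expectation (nu : probability config R) (beta : R)
    (P : seq (seq (oedge L))) (s : seq (seq (oedge L))) : R[i] :=
  (cintegral nu (density beta P))^-1 *
  cintegral nu (fun Q => wilson s Q * density beta P Q).

End YangMills.

(* Main.v *)
Require Import Defs.
From HB Require Import structures.
From mathcomp Require Import all_boot all_order all_algebra.
From mathcomp Require Import complex.
From mathcomp Require Import all_classical all_reals all_analysis.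
From mathcomp Require Import measurable_realfun.
From mathcomp Require Import ring lra zify.

Set Implicit Arguments.
Unset Strict Implicit.
Unset Printing Implicit Defensive.
Import Order.TTheory GRing.Theory Num.Theory.
Import numFieldNormedType.Exports.

Local Open Scope ring_scope.
Local Open Scope complex_scope.
Import ComplexField.Normc.

(** The equation is integration by parts on one copy of U(N): Haar measure is
invariant under translation, so the integral of any derivative along a
one-parameter group acting on the edge variable of [e] vanishes.

The function that is differentiated is [M a b * rest * density], where [M] is
the holonomy of [l_i] read from the location [(i, j)] on, and [rest] is the
product of the other Wilson loops.  A tangent direction of U(N) is an
anti-hermitian matrix; since the derivative is complex linear in the direction
[X], the vanishing holds for every complex matrix [X] ([schwinger_dyson]), in
particular for the elementary matrix [delta_mx a b].  Summing over [a] and [b]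
contracts the indices: an insertion of [delta_mx a b] in [M] itself cuts the
loop into two traces, and an insertion in another trace glues that trace to
[M].  Thus the letter at [(i, j)] gives [N * tr M], which is the left-hand
side; the other letters [e] and [einv e] of [l_i] give the splittings, those of
the other loops the mergers ([sum_split], [sum_merge]), and those of the
plaquettes in the exponent of the density the deformations ([sum_deform]).  A
letter [einv e] contributes with the opposite sign because the inverse of
[g Q] is differentiated.

Three devices keep the analysis elementary.
- The one-parameter families are [1 + chord t *: A] for a hermitian projection
  [A], with [1 + chord t = (1 + i t) / (1 - i t)] on the unit circle
  ([rotation_mx]).  Projections span all matrices by polarization
  ([delta_vanish]), so no exponential of matrices is needed.
- Differentiation under the integral is replaced by [jet]: a first-order
  expansion along the flow with a quadratic remainder that is uniform in the
  configuration.  Jets are stable under sums, products and [cexp], and a jet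
  along a measure-preserving flow has a derivative of integral zero
  ([cintegral_jet]).
- Only left translations of the edge variables are used.  When [e] is a reversed
  edge, its matrix is multiplied on the right, and the place where [X] is
  inserted moves from the front of the letter [e] to its back.  All formulas are
  therefore written with cut points [k + ~~ e.2] for [e] and [k + e.2] for
  [einv e]. *)

(** * Estimates for the complex exponential *)

Section ComplexEstimates.
Local Open Scope classical_set_scope.
Local Open Scope ring_scope.
Variable R : realType.
Implicit Types (z w : R[i]) (x y t : R).

Lemma normc_ge0 z : 0 <= normc z.
Proof. by case: z => a b; rewrite sqrtr_ge0. Qed.

Lemma normcD z w : normc (z + w) <= normc z + normc w.
Proof. exact: le_normcD. Qed.

Lemma normc_opp z : normc (- z) = normc z.
Proof. exact: normcN. Qed.

Lemma normc_real x : normc x%:C = `|x|.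
Proof. by rewrite /= expr0n addr0 sqrtr_sqr. Qed.

Lemma normc_imag x : normc (0 +i* x) = `|x|.
Proof. by rewrite /= expr0n add0r sqrtr_sqr. Qed.

Lemma Re_normc z : `|complex.Re z| <= normc z.
Proof.
by case: z => a b /=; rewrite -[`|a|]sqrtr_sqr ler_wsqrtr// lerDl sqr_ge0.
Qed.

Lemma Im_normc z : `|complex.Im z| <= normc z.
Proof.
by case: z => a b /=; rewrite -[`|b|]sqrtr_sqr ler_wsqrtr// lerDr sqr_ge0.
Qed.

Lemma normc_ReIm x y : normc (x +i* y) <= `|x| + `|y|.
Proof.
rewrite -normc_real -[`|y|]normc_imag (_ : x +i* y = x%:C + 0 +i* y) ?normcD//.
by simpc.
Qed.

Lemma ReD z w : complex.Re (z + w) = complex.Re z + complex.Re w.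
Proof. by case: z w => [a b] [c d]. Qed.
Lemma ImD z w : complex.Im (z + w) = complex.Im z + complex.Im w.
Proof. by case: z w => [a b] [c d]. Qed.
Lemma ReM z w : complex.Re (z * w) =
  complex.Re z * complex.Re w - complex.Im z * complex.Im w.
Proof. by case: z w => [a b] [c d]. Qed.
Lemma ImM z w : complex.Im (z * w) =
  complex.Re z * complex.Im w + complex.Im z * complex.Re w.
Proof. by case: z w => [a b] [c d]. Qed.

Lemma cexpD z w : cexp (z + w) = cexp z * cexp w.
Proof.
by case: z w => [a b] [c d]; rewrite /cexp /= expRD cosD sinD; simpc;
  congr (_ +i* _); ring.
Qed.

Lemma normc_cexp z : normc (cexp z) = expR (complex.Re z).
Proof.
rewrite /cexp /= !exprMn -mulrDr cos2Dsin2 mulr1 sqrtr_sqr.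
by rewrite ger0_norm ?expR_ge0.
Qed.

(** Both one-sided bounds come from [1 + y <= expR y], at [y = x] and at
[y = - x]; no derivative is involved. *)
Lemma expR_taylor2 x : `|expR x - 1 - x| <= x ^+ 2 * (1 + expR x).
Proof.
have h1 := expR_ge1Dx x; have h2 := expR_ge1Dx (- x).
have h3 : expR x * expR (- x) = 1 by rewrite -expRD subrr expR0.
have h4 := expR_gt0 x.
have h5 : expR x * (1 - x) <= 1 by rewrite -[leRHS]h3 ler_pM2l.
rewrite ger0_norm; last by lra.
have e2 : 0 <= x ^+ 2 * expR x by rewrite mulr_ge0 ?sqr_ge0 ?expR_ge0.
have [x0|x0] := leP 0 x.
  have : 0 <= x * (1 + x * expR x - expR x) by apply: mulr_ge0 => //; lra.
  by have := sqr_ge0 x; lra.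
have : 0 <= (- x) * (expR x - 1 - x) by apply: mulr_ge0; lra.
by lra.
Qed.

Lemma sin_le_norm x : `|sin x| <= `|x|.
Proof.
wlog x0 : x / 0 < x.
  move=> h; have [x0|x0|->] := ltgtP x 0; last by rewrite sin0.
    by have := h (- x); rewrite sinN !normrN; apply; lra.
  exact: h.
have cs : {within `[0, x], continuous (@sin R)}.
  by apply: continuous_subspaceT => y; exact: continuous_sin.
have [c _] := MVT x0 (fun y _ => is_derive_sin y) cs.
rewrite sin0 !subr0 => ->; rewrite normrM; have := cos_max c.
by have := normr_ge0 x; nra.
Qed.

Lemma cos_taylor2 x : `|cos x - 1| <= x ^+ 2.
Proof.
have -> : cos x - 1 = - (2 * sin (x / 2) ^+ 2).
  by rewrite [in LHS](_ : x = (x / 2) *+ 2) ?cos_mulr2n ?cos2sin2; [ring|field].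
rewrite normrN ger0_norm; last by rewrite mulr_ge0 ?sqr_ge0.
have -> : x ^+ 2 = 4 * `|x / 2| ^+ 2 by rewrite real_normK ?num_real//; field.
rewrite -(real_normK (num_real (sin _))).
move: (sin_le_norm (x / 2)) (normr_ge0 (sin (x / 2))).
move: `|sin _| `|x / 2| => a b ab a0.
by have : a ^+ 2 <= b ^+ 2 by [rewrite lerXn2r ?nnegrE; lra]; have := sqr_ge0 a; lra.
Qed.

Lemma sin_taylor2 x : `|sin x - x| <= `|x| * x ^+ 2.
Proof.
wlog x0 : x / 0 < x.
  move=> h; have [x0|x0|->] := ltgtP x 0; last by rewrite sin0 subr0 normr0 mul0r.
    by have := h (- x); rewrite sinN sqrrN -opprD !normrN; apply; lra.
  exact: h.
have cs : {within `[0, x], continuous (@sin R \- id)}.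
  apply: continuous_subspaceT => y; apply: cvgB; last exact: cvg_id.
  exact: continuous_sin.
have dB y : is_derive y 1 (@sin R \- id) (cos y - 1) by apply: is_deriveB.
have [c] := MVT x0 (fun y _ => dB y) cs.
rewrite in_itv /= sin0 !subr0 => /andP[c0 cx] ->; rewrite normrM mulrC.
rewrite ler_wpM2l//; apply: le_trans (cos_taylor2 c) _.
by rewrite lerXn2r ?nnegrE ?ltW.
Qed.

(** The constant depends only on a bound for [z], which is what an expansion
uniform over the configurations requires. *)
Lemma cexp_taylor2 (K : R) : exists C, 0 <= C /\
  forall z, normc z <= K -> normc (cexp z - 1 - z) <= C * normc z ^+ 2.
Proof.
have [K0|K0] := ltP K 0.
  exists 0; split=> // z zK; have := normc_ge0 z; lra.
have E0 := expR_ge0 K.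
exists (1 + expR K + expR K + (expR K * K + (1 + K * (1 + expR K)))); split; first nra.
move=> z zK.
set n := normc z in zK *; have n0 : 0 <= n := normc_ge0 z.
have xn := Re_normc z; have yn := Im_normc z; rewrite -/n in xn yn.
case: z @n zK n0 xn yn => x y n nK n0 xn yn; rewrite [complex.Re _]/= in xn.
rewrite [complex.Im _]/= in yn.
(* The remainder in terms of those of the exponential, cosine and sine. *)
have eq : cexp (x +i* y) - 1 - (x +i* y) =
  (expR x - 1 - x + expR x * (cos y - 1)) +i*
  (expR x * (sin y - y) + (expR x - 1) * y).
  by rewrite /cexp /=; simpc; congr (_ +i* _); ring.
rewrite eq; apply: le_trans (normc_ReIm _ _) _.
have ex : expR x <= expR K.
  by rewrite ler_expR; apply: le_trans (ler_norm x) (le_trans xn _).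
have e0 := expR_ge0 x.
have x2 : x ^+ 2 <= n ^+ 2 by rewrite -real_normK ?num_real// lerXn2r ?nnegrE.
have y2 : y ^+ 2 <= n ^+ 2 by rewrite -real_normK ?num_real// lerXn2r ?nnegrE.
have n2 : 0 <= n ^+ 2 := sqr_ge0 n.
have b1 : `|expR x - 1 - x| <= n ^+ 2 * (1 + expR K).
  by apply: le_trans (expR_taylor2 x) _; apply: ler_pM => //; rewrite ?sqr_ge0//; lra.
have b2 : `|expR x * (cos y - 1)| <= expR K * n ^+ 2.
  rewrite normrM (ger0_norm e0); apply: ler_pM => //.
  exact: le_trans (cos_taylor2 y) _.
have b3 : `|expR x * (sin y - y)| <= expR K * (K * n ^+ 2).
  rewrite normrM (ger0_norm e0); apply: ler_pM => //.
  apply: le_trans (sin_taylor2 y) _; apply: ler_pM => //; rewrite ?sqr_ge0//; lra.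
have b4 : `|(expR x - 1) * y| <= (n + n ^+ 2 * (1 + expR K)) * n.
  rewrite normrM; apply: ler_pM => //.
  rewrite (_ : expR x - 1 = x + (expR x - 1 - x)); last by ring.
  by apply: le_trans (ler_normD _ _) _; apply: lerD.
have b5 : n ^+ 2 * (1 + expR K) * n <= n ^+ 2 * (1 + expR K) * K.
  by apply: ler_wpM2l => //; apply: mulr_ge0 => //; lra.
have := ler_normD (expR x - 1 - x) (expR x * (cos y - 1)).
have := ler_normD (expR x * (sin y - y)) ((expR x - 1) * y).
nra.
Qed.

End ComplexEstimates.

(** * Bounded measurable complex functions and their integrals *)

Section Observables.
Variables (R : realType) (d : measure_display) (T : measurableType d).
Implicit Types (F G : T -> R[i]).

(** Under a probability measure, boundedness makes these functions integrable,
and unlike integrable functions they are closed under products. *)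
Definition observable F :=
  [/\ exists K, forall x, normc (F x) <= K,
      measurable_fun setT (fun x => complex.Re (F x))
    & measurable_fun setT (fun x => complex.Im (F x))].

Lemma eq_observable F G : F =1 G -> observable F -> observable G.
Proof. by move=> /funext ->. Qed.

Lemma observable_cst z : observable (fun=> z).
Proof. by split; [exists (normc z)|exact: measurable_cst|exact: measurable_cst]. Qed.

Lemma observableD F G : observable F -> observable G ->
  observable (fun x => F x + G x).
Proof.
move=> [[K FK] rF iF] [[K' GK] rG iG]; split.
- by exists (K + K') => x; apply: le_trans (normcD _ _) (lerD (FK x) (GK x)).
- by under eq_fun do rewrite ReD; exact: measurable_funD.
- by under eq_fun do rewrite ImD; exact: measurable_funD.
Qed.

Lemma observableM F G : observable F -> observable G ->
  observable (fun x => F x * G x).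
Proof.
move=> [[K FK] rF iF] [[K' GK] rG iG]; split.
- by exists (K * K') => x; rewrite normcM ler_pM ?normc_ge0.
- under eq_fun do rewrite ReM.
  by apply: measurable_funB; exact: measurable_funM.
- under eq_fun do rewrite ImM.
  by apply: measurable_funD; exact: measurable_funM.
Qed.

Lemma observableN F : observable F -> observable (fun x => - F x).
Proof.
move=> oF; apply: eq_observable (observableM (observable_cst (-1)) oF) => x.
by rewrite mulN1r.
Qed.

Lemma observable_sum (I : Type) (r : seq I) (P : pred I) (F : I -> T -> R[i]) :
  (forall i, P i -> observable (F i)) ->
  observable (fun x => \sum_(i <- r | P i) F i x).
Proof.
move=> oF; elim: r => [|i r IH].
  by apply: eq_observable (observable_cst 0) => x; rewrite big_nil.
under eq_fun do rewrite big_cons.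
by case: (boolP (P i)) => Pi //; apply: observableD => //; exact: oF.
Qed.

Lemma observable_prod (I : Type) (r : seq I) (P : pred I) (F : I -> T -> R[i]) :
  (forall i, P i -> observable (F i)) ->
  observable (fun x => \prod_(i <- r | P i) F i x).
Proof.
move=> oF; elim: r => [|i r IH].
  by apply: eq_observable (observable_cst 1) => x; rewrite big_nil.
under eq_fun do rewrite big_cons.
by case: (boolP (P i)) => Pi //; apply: observableM => //; exact: oF.
Qed.

Lemma observable_cexp F : observable F -> observable (fun x => cexp (F x)).
Proof.
move=> [[K FK] rF iF]; split.
- exists (expR K) => x; rewrite normc_cexp ler_expR.
  by apply: le_trans (ler_norm _) (le_trans (Re_normc _) (FK x)).
- rewrite /cexp /=; apply: measurable_funM; first exact: measurableT_comp.
  apply: (measurableT_comp _ iF); apply: continuous_measurable_fun.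
  exact: continuous_cos.
- rewrite /cexp /=; apply: measurable_funM; first exact: measurableT_comp.
  apply: (measurableT_comp _ iF); apply: continuous_measurable_fun.
  exact: continuous_sin.
Qed.

Lemma observable_integrable (mu : probability T R) F : observable F ->
  mu.-integrable setT (EFin \o (fun x => complex.Re (F x))) /\
  mu.-integrable setT (EFin \o (fun x => complex.Im (F x))).
Proof.
move=> [[K FK] rF iF]; have mu1 : (mu setT < +oo)%E.
  by rewrite probability_setT ltry.
have bd (f : T -> R) : (forall x, `|f x| <= K) ->
    \forall M \near +oo, forall x, setT x -> `|f x| <= M.
  by move=> fK; exists K; split=> [|M KM x _]; rewrite ?num_real ?(le_trans (fK x)) ?ltW.
split; apply: measurable_bounded_integrable => //; apply: bd => x.
  exact: le_trans (Re_normc _) (FK x).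
exact: le_trans (Im_normc _) (FK x).
Qed.

End Observables.

Section ComplexIntegral.
Variables (R : realType) (N : nat) (L : graph).
Variable nu : probability (config R N L) R.
Implicit Types (F G : config R N L -> R[i]).

Lemma eq_cintegral F G : F =1 G -> cintegral nu F = cintegral nu G.
Proof. by move=> /funext ->. Qed.

Lemma cintegral_cst z : cintegral nu (fun=> z) = z.
Proof.
rewrite /cintegral !Rintegral_cst//= probability_setT /= !mulr1.
by case: z.
Qed.

Lemma cintegralD F G : observable F -> observable G ->
  cintegral nu (fun Q => F Q + G Q) = cintegral nu F + cintegral nu G.
Proof.
move=> /(observable_integrable nu)[rF iF] /(observable_integrable nu)[rG iG].
rewrite /cintegral; under eq_Rintegral do rewrite ReD.
under [X in _ +i* X = _]eq_Rintegral do rewrite ImD.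
by rewrite !RintegralD//; simpc.
Qed.

Lemma cintegralZ z F : observable F ->
  cintegral nu (fun Q => z * F Q) = z * cintegral nu F.
Proof.
move=> /(observable_integrable nu)[rF iF].
have rZ x : nu.-integrable setT (EFin \o (fun Q => x * complex.Re (F Q))).
  exact: (integrableZl measurableT x rF).
have iZ x : nu.-integrable setT (EFin \o (fun Q => x * complex.Im (F Q))).
  exact: (integrableZl measurableT x iF).
rewrite /cintegral; under eq_Rintegral do rewrite ReM.
under [X in _ +i* X = _]eq_Rintegral do rewrite ImM.
rewrite RintegralB// RintegralD// !RintegralZl//.
by case: z => a b; simpc.
Qed.

Lemma cintegralN F : observable F ->
  cintegral nu (fun Q => - F Q) = - cintegral nu F.
Proof.
move=> oF; rewrite -mulN1r -cintegralZ//.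
by apply: eq_cintegral => Q; rewrite mulN1r.
Qed.

Lemma cintegralB F G : observable F -> observable G ->
  cintegral nu (fun Q => F Q - G Q) = cintegral nu F - cintegral nu G.
Proof.
by move=> oF oG; rewrite cintegralD ?cintegralN//; exact: observableN.
Qed.

Lemma cintegral_sum (I : Type) (r : seq I) (F : I -> config R N L -> R[i]) :
  (forall i, observable (F i)) ->
  cintegral nu (fun Q => \sum_(i <- r) F i Q) = \sum_(i <- r) cintegral nu (F i).
Proof.
move=> oF; elim: r => [|i r IH].
  rewrite big_nil -[RHS]cintegral_cst.
  by apply: eq_cintegral => Q; rewrite big_nil.
rewrite big_cons -IH -cintegralD//; last exact: observable_sum.
by apply: eq_cintegral => Q; rewrite big_cons.
Qed.

(** The factor two comes from bounding the real and imaginary parts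
separately. *)
Lemma normc_cintegral F K : observable F -> (forall Q, normc (F Q) <= K) ->
  normc (cintegral nu F) <= K + K.
Proof.
move=> oF FK; have [rF iF] := observable_integrable nu oF.
have le1 (f : config R N L -> R) : nu.-integrable setT (EFin \o f) ->
    (forall Q, `|f Q| <= K) -> `|\int[nu]_Q f Q| <= K.
  move=> fi fK; apply: le_trans (le_normr_Rintegral _ fi) _ => //.
  have -> : K = \int[nu]_(x in setT) K.
    by rewrite Rintegral_cst//= probability_setT mulr1.
  apply: le_Rintegral => //; first exact: integrable_norm.
  by have [] := observable_integrable nu (observable_cst _ K%:C).
apply: le_trans (normc_ReIm _ _) _; apply: lerD; apply: le1 => // Q.
  exact: le_trans (Re_normc _) (FK Q).
exact: le_trans (Im_normc _) (FK Q).
Qed.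

End ComplexIntegral.

(** * Uniform first-order expansions along a flow *)

Section Jets.
Variables (R : realType) (T : Type) (flow : R -> T -> T).
Implicit Types (F G : T -> R[i]).

(** [F1] is the derivative of [F] along [flow] at time 0.  Uniformity in [x]
lets the expansion be integrated; the bounds on [F] and [F1] make the relation
stable under products. *)
Definition jet F F1 := exists2 K, 0 <= K & forall t x, `|t| <= 1 ->
  [/\ normc (F x) <= K, normc (F1 x) <= K
    & normc (F (flow t x) - F x - t%:C * F1 x) <= K * t ^+ 2].

Lemma eq_jet F F1 G G1 : F =1 G -> F1 =1 G1 -> jet F F1 -> jet G G1.
Proof. by move=> /funext -> /funext ->. Qed.

Lemma jet_cst z : jet (fun=> z) (fun=> 0).
Proof.
exists (normc z) => [|t x _]; first exact: normc_ge0.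
rewrite normc0 mulr0 !subr0 subrr normc0.
by split=> //; [|apply: mulr_ge0; last exact: sqr_ge0]; exact: normc_ge0.
Qed.

Lemma jetD F F1 G G1 : jet F F1 -> jet G G1 ->
  jet (fun x => F x + G x) (fun x => F1 x + G1 x).
Proof.
move=> [K K0 FK] [K' K'0 GK]; exists (K + K') => [|t x t1]; first exact: addr_ge0.
have [f f1 ft] := FK t x t1; have [g g1 gt] := GK t x t1.
split; first exact: le_trans (normcD _ _) (lerD f g).
  exact: le_trans (normcD _ _) (lerD f1 g1).
rewrite mulrDl; apply: le_trans _ (lerD ft gt); apply: le_trans _ (normcD _ _).
by rewrite le_eqVlt; apply/orP; left; apply/eqP; congr normc; ring.
Qed.

Lemma jetM F F1 G G1 : jet F F1 -> jet G G1 ->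
  jet (fun x => F x * G x) (fun x => F1 x * G x + F x * G1 x).
Proof.
move=> [K K0 FK] [K' K'0 GK]; have KK' : 0 <= K * K' by exact: mulr_ge0.
exists (4 * (K * K')) => [|t x t1]; first by lra.
have [f f1 ft] := FK t x t1; have [g g1 gt] := GK t x t1.
have [gf _ _] := GK t (flow t x) t1.
have bM y z (A B : R) : normc y <= A -> normc z <= B -> normc (y * z) <= A * B.
  by move=> yA zB; rewrite normcM ler_pM ?normc_ge0.
split.
- by apply: le_trans (bM _ _ _ _ f g) _; lra.
- apply: le_trans (normcD _ _) _.
  by have := bM _ _ _ _ f1 g; have := bM _ _ _ _ f g1; lra.
have tt : normc t%:C <= 1 by rewrite normc_real.
set rF := F (flow t x) - _ - _ in ft; set rG := G (flow t x) - _ - _ in gt.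
(* The remainder of each factor times the other factor, and the product of the
   two first-order terms. *)
have -> : F (flow t x) * G (flow t x) - F x * G x -
    t%:C * (F1 x * G x + F x * G1 x) =
  rF * G (flow t x) + (F x + t%:C * F1 x) * rG + (t ^+ 2)%:C * (F1 x * G1 x).
  by rewrite rmorphXn /= /rF /rG; ring.
have b1 := bM _ _ _ _ ft gf.
have b2 : normc (F x + t%:C * F1 x) <= K + 1 * K.
  by apply: le_trans (normcD _ _) (lerD f (bM _ _ _ _ tt f1)).
have b3 := bM _ _ _ _ b2 gt.
have tt2 : normc (t ^+ 2)%:C <= t ^+ 2 by rewrite normc_real ger0_norm ?sqr_ge0.
have b4 := bM _ _ _ _ tt2 (bM _ _ _ _ f1 g1).
apply: le_trans (normcD _ _) _; apply: le_trans (lerD (normcD _ _) (lexx _)) _.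
lra.
Qed.

Lemma jetMl z F F1 : jet F F1 -> jet (fun x => z * F x) (fun x => z * F1 x).
Proof.
move=> jF; apply: eq_jet (jetM (jet_cst z) jF) => x //.
by rewrite mul0r add0r.
Qed.

Lemma jet_sum (I : Type) (r : seq I) (P : pred I) (F F1 : I -> T -> R[i]) :
  (forall i, jet (F i) (F1 i)) ->
  jet (fun x => \sum_(i <- r | P i) F i x) (fun x => \sum_(i <- r | P i) F1 i x).
Proof.
move=> jF; elim: r => [|i r IH].
  by apply: eq_jet (jet_cst 0) => x; rewrite big_nil.
under eq_fun do rewrite big_cons; under [X in jet _ X]eq_fun do rewrite big_cons.
by case: (P i) => //; exact: jetD.
Qed.

(** Leibniz rule; the indices are distinct, so that [k != i] omits exactly one
factor. *)
Lemma jet_prod (I : eqType) (r : seq I) (F F1 : I -> T -> R[i]) :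
  uniq r -> (forall i, jet (F i) (F1 i)) ->
  jet (fun x => \prod_(i <- r) F i x)
      (fun x => \sum_(i <- r) F1 i x * \prod_(k <- r | k != i) F k x).
Proof.
move=> + jF; elim: r => [_|i r IH /= /andP[ir ur]].
  by apply: eq_jet (jet_cst 1) => x; rewrite big_nil.
apply: eq_jet (jetM (jF i) (IH ur)) => x; first by rewrite big_cons.
rewrite !big_cons eqxx /=; congr (_ * _ + _).
  rewrite big_seq [RHS]big_seq_cond; apply: eq_bigl => k.
  by case: eqP => [->|//]; rewrite ?andbF ?andbT// (negbTE ir).
rewrite mulr_sumr; apply: eq_big_seq => k kr.
rewrite big_cons (_ : i != k); last by apply: contraNneq ir => ->.
by rewrite mulrCA.
Qed.

(** [cexp (F (flow t x)) = cexp (F x) * cexp h] with [h] the increment of [F],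
which is [O(t)] and bounded, so that [cexp_taylor2] applies to [h]. *)
Lemma jet_cexp F F1 : jet F F1 ->
  jet (fun x => cexp (F x)) (fun x => cexp (F x) * F1 x).
Proof.
move=> [K K0 FK]; have [C [C0 cK]] := cexp_taylor2 (2 * K).
have E0 := expR_ge0 K.
have A0 : 0 <= C * (2 * K) ^+ 2 + K by rewrite addr_ge0 ?mulr_ge0 ?sqr_ge0.
exists (expR K + expR K * K + expR K * (C * (2 * K) ^+ 2 + K)) => [|t x t1].
  by rewrite !addr_ge0 ?mulr_ge0 ?sqr_ge0.
have [f f1 ft] := FK t x t1.
have e : normc (cexp (F x)) <= expR K.
  rewrite normc_cexp ler_expR; apply: le_trans (ler_norm _) _.
  exact: le_trans (Re_normc _) f.
have EA0 : 0 <= expR K * (C * (2 * K) ^+ 2 + K) by exact: mulr_ge0.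
have EK0 : 0 <= expR K * K by exact: mulr_ge0.
have ef1 : normc (cexp (F x) * F1 x) <= expR K * K.
  by rewrite normcM ler_pM ?normc_ge0.
split; [lra|lra|].
set h := F (flow t x) - F x in ft.
have -> : cexp (F (flow t x)) - cexp (F x) - t%:C * (cexp (F x) * F1 x) =
  cexp (F x) * ((cexp h - 1 - h) + (h - t%:C * F1 x)).
  by rewrite -{1}(subrK (F x) (F (flow t x))) -/h cexpD; ring.
have t2 : t ^+ 2 <= `|t|.
  by rewrite -real_normK ?num_real// expr2 ler_piMr.
have ht : normc h <= 2 * K * `|t|.
  rewrite -(subrK (t%:C * F1 x) h); apply: le_trans (normcD _ _) _.
  have : normc (t%:C * F1 x) <= `|t| * K.
    by rewrite normcM normc_real ler_wpM2l.
  have : K * t ^+ 2 <= K * `|t| by exact: ler_wpM2l.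
  lra.
have hK : normc h <= 2 * K.
  by apply: le_trans ht _; rewrite ler_piMr// mulr_ge0.
have h2 : normc h ^+ 2 <= (2 * K) ^+ 2 * t ^+ 2.
  rewrite -[t ^+ 2]real_normK ?num_real// -exprMn lerXn2r ?nnegrE ?normc_ge0//.
  by rewrite !mulr_ge0.
have b : normc ((cexp h - 1 - h) + (h - t%:C * F1 x)) <=
    (C * (2 * K) ^+ 2 + K) * t ^+ 2.
  apply: le_trans (normcD _ _) _; rewrite mulrDl; apply: lerD => //.
  by apply: le_trans (cK _ hK) _; rewrite -mulrA ler_wpM2l.
rewrite normcM; apply: (@le_trans _ _ (expR K * ((C * (2 * K) ^+ 2 + K) * t ^+ 2))).
  by rewrite ler_pM ?normc_ge0.
by rewrite mulrA ler_wpM2r ?sqr_ge0//; lra.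
Qed.

End Jets.

Section StationaryIntegral.
Variables (R : realType) (N : nat) (L : graph).
Variable nu : probability (config R N L) R.
Variable flow : R -> config R N L -> config R N L.
Hypothesis flow_nu : forall t F, observable F ->
  observable (fun Q => F (flow t Q)) /\
  cintegral nu (fun Q => F (flow t Q)) = cintegral nu F.

(** By invariance, the integral of [F (flow t Q) - F Q] is zero, so
[t] times the integral of [F1] is at most a constant times [t ^+ 2]; divide by a
small [t]. *)
Lemma cintegral_jet F F1 : observable F -> observable F1 -> jet flow F F1 ->
  cintegral nu F1 = 0.
Proof.
move=> oF oF1 [K K0 FK]; apply: eq0_normc.
set c := normc _; have c0 : 0 <= c := normc_ge0 _.
have bd t : `|t| <= 1 -> `|t| * c <= 2 * K * t ^+ 2.
  move=> t1; have [oFt iFt] := flow_nu t oF.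
  have otF1 : observable (fun Q => t%:C * F1 Q).
    by apply: observableM => //; exact: observable_cst.
  have oFB : observable (fun Q => F (flow t Q) - F Q).
    by apply: observableD => //; exact: observableN.
  have := normc_cintegral nu (observableD oFB (observableN otF1)) (K := K * t ^+ 2).
  rewrite cintegralB// cintegralB// iFt subrr sub0r normc_opp cintegralZ//.
  rewrite normcM normc_real -/c => h; apply: le_trans (h _) _; last lra.
  by move=> Q; have [] := FK t Q t1.
apply/eqP; rewrite eq_le c0 andbT leNgt; apply/negP => cp.
(* Small enough for [2 * K * t < c]. *)
pose t := c / (c + 2 * K + 1); have D0 : 0 < c + 2 * K + 1 by lra.
have t0 : 0 < t by rewrite divr_gt0.
have t1 : t <= 1 by rewrite ler_pdivrMr//; lra.
have := bd t; rewrite gtr0_norm// => /(_ t1).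
rewrite expr2 mulrCA ler_pM2l//; apply/negP; rewrite -ltNge.
rewrite /t mulrA ltr_pdivrMr// mulrC ltr_pM2l//; lra.
Qed.

End StationaryIntegral.

(** * Topology of the unitary group *)

Section UnitaryTopology.
Variables (R : realType) (N : nat).
Local Open Scope classical_set_scope.
Local Open Scope ring_scope.
Local Notation C := R[i].
Local Notation U := (unitary R N).
Local Notation BU := (borel_unitary R N).
Implicit Types (g q : U) (a b : 'I_N).

Lemma umxP q : umx q \is unitarymx.
Proof. exact: set_mem (valP q). Qed.

Lemma umx_inj : injective (@umx R N).
Proof. exact: val_inj. Qed.

Lemma Re_continuous : continuous (fun z : C => complex.Re z).
Proof.
move=> z A /nbhs_ballP[e /= e0 eA]; apply/nbhs_ballP; exists e%:C => [|w].
  by rewrite /= ltcR.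
rewrite /ball /= => zw; apply: eA; rewrite /ball /=.
rewrite -ltcR; apply: le_lt_trans zw; rewrite normc_def lecR.
rewrite -[X in X <= _]sqrtr_sqr; apply: ler_wsqrtr.
by case: z w => [x y] [x' y'] /=; rewrite lerDl sqr_ge0.
Qed.

Lemma Im_continuous : continuous (fun z : C => complex.Im z).
Proof.
move=> z A /nbhs_ballP[e /= e0 eA]; apply/nbhs_ballP; exists e%:C => [|w].
  by rewrite /= ltcR.
rewrite /ball /= => zw; apply: eA; rewrite /ball /=.
rewrite -ltcR; apply: le_lt_trans zw; rewrite normc_def lecR.
rewrite -[X in X <= _]sqrtr_sqr; apply: ler_wsqrtr.
by case: z w => [x y] [x' y'] /=; rewrite lerDr sqr_ge0.
Qed.

Lemma mx_entry_continuous a b : continuous (fun M : 'M[C]_N => M a b).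
Proof.
move=> M A MA; exists (fun i j => if (i == a) && (j == b) then A else setT).
  by move=> i j; case: ifP => [/andP[/eqP-> /eqP->]//|_]; exact: filterT.
by move=> M' /(_ a b); rewrite !eqxx.
Qed.

(** The topology of matrices is that of entrywise convergence. *)
Lemma mx_continuous (T : topologicalType) (f : T -> 'M[C]_N) :
  (forall a b, continuous (fun x => f x a b)) -> continuous f.
Proof.
move=> cf x A [P fP PA].
have : \forall y \near x, forall a b, P a b (f y a b).
  apply: filter_forall => a; apply: filter_forall => b.
  exact: cf (fP a b).
by apply: filterS => y; exact: PA.
Qed.

Lemma umx_continuous : continuous (@umx R N).
Proof. exact: initial_continuous. Qed.

Lemma umx_entry_continuous a b : continuous (fun q : U => umx q a b).
Proof.
move=> q; apply: (@continuous_comp _ _ _ (@umx R N) (fun M : 'M[C]_N => M a b)).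
  exact: umx_continuous.
exact: mx_entry_continuous.
Qed.

Lemma lin_comb_continuous (T : topologicalType) (c : 'I_N -> C)
    (f : 'I_N -> T -> C^o) :
  (forall k, continuous (f k)) -> continuous (fun x => \sum_k (c k : C^o) * f k x).
Proof.
move=> cf; apply: continuous_big => [|k _]; first exact: add_continuous.
by move=> x; apply: cvgM; [exact: cvg_cst|exact: cf].
Qed.

Lemma umul_continuous g : continuous (umul g).
Proof.
apply: continuous_comp_initial; apply: mx_continuous => a b.
rewrite [X in continuous X](_ : _ =
  (fun q : U => \sum_k (umx g a k : C^o) * (umx q k b : C^o))); last first.
  by apply/funext => q; rewrite /= -[set_val _]/(umx g *m umx q) mxE.
by apply: lin_comb_continuous => k; exact: umx_entry_continuous.
Qed.

Lemma measurable_continuous (f : U -> R) : continuous f ->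
  measurable_fun setT (f : BU -> R).
Proof.
move=> /continuousP cf; apply: (measurability _ (RGenOpens.measurableE R)).
move=> _ [_ [a [b ->] <-]]; rewrite setTI; apply: sub_sigma_algebra.
exact/cf/interval_open.
Qed.

Lemma measurable_umul g : measurable_fun setT (umul g : BU -> BU).
Proof.
apply: (@measurability _ _ BU BU setT (umul g) (@open U)) => // _ [A oA <-].
rewrite setTI.
by apply: sub_sigma_algebra; move/continuousP: (@umul_continuous g); exact.
Qed.

Lemma sqr_normc (z : C) : z * Num.conj z = (normc z ^+ 2)%:C.
Proof.
rewrite -[Num.conj z]/(conjc z); case: z => x y; rewrite [conjc _]/=; simpc.
by rewrite /= sqr_sqrtr ?addr_ge0 ?sqr_ge0// -!expr2; simpc; rewrite [y * x]mulrC addNr.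
Qed.

Lemma normc_unitarymx (M : 'M[C]_N) a b : M \is unitarymx -> normc (M a b) <= 1.
Proof.
move=> /unitarymxP/(congr1 (fun A : 'M[C]_N => A a a)); rewrite !mxE eqxx mulr1n.
under eq_bigr do rewrite !mxE sqr_normc.
rewrite -rmorph_sum => /= /complexI s1.
rewrite -(@expr_le1 _ 2)// ?normc_ge0// -s1 (bigD1 b)//= lerDl.
by apply: sumr_ge0 => k _; rewrite sqr_ge0.
Qed.

End UnitaryTopology.

(** * Translations of one edge variable preserve the product measure *)

Section EdgeTranslation.
Variables (R : realType) (N : nat) (L : graph).
Local Open Scope classical_set_scope.
Local Open Scope ring_scope.
Local Notation U := (unitary R N).
Local Notation BU := (borel_unitary R N).
Local Notation config := (config R N L).
Implicit Types (g q : U) (e x : pos_edge L).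

Definition translate x g (Q : config) : config :=
  fun e => if e == x then umul g (Q e) else Q e.

Definition box (A : pos_edge L -> set BU) : set config :=
  [set Q | forall e, A e (Q e)].

Lemma measurable_coord e : measurable_fun setT (fun Q : config => Q e : BU).
Proof.
move=> _ A mA; rewrite setTI; apply: sub_sigma_algebra.
by exists e, A.
Qed.

Lemma measurable_to_config d (T : measurableType d) (f : T -> config) :
  (forall e, measurable_fun setT (fun t => f t e : BU)) -> measurable_fun setT f.
Proof.
move=> mf; apply: (@measurability _ _ T config setT f [set B |
  exists e (A : set BU), measurable A /\ B = [set Q | A (Q e)]]).
  by [].
move=> _ [_ [e [A [mA ->]]] <-].
exact: mf.
Qed.

Lemma measurable_translate x g : measurable_fun setT (translate x g).
Proof.
apply: measurable_to_config => e; rewrite /translate.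
case: (e == x); last exact: measurable_coord.
exact: measurableT_comp (measurable_umul g) (measurable_coord e).
Qed.

Lemma measurable_box A : (forall e, measurable (A e)) -> measurable (box A).
Proof.
move=> mA; rewrite (_ : box A =
    \bigcap_(e in [set: pos_edge L]) ((fun Q : config => Q e : BU) @^-1` A e)).
  apply: fin_bigcap_measurable => [|e _]; first exact: finite_finset.
  by rewrite -[X in measurable X]setTI; exact: measurable_coord.
by apply/seteqP; split=> Q h e; [move=> _; exact: h|exact: h e I].
Qed.

(** Boxes form a pi-system generating the sigma-algebra of configurations, so a
measure is determined by its values on them. *)
Lemma measurable_configE :
  @measurable _ config = <<s [set B | exists2 A : pos_edge L -> set BU,
    (forall e, measurable (A e)) & B = box A] >>.
Proof.
apply/seteqP; split; apply: smallest_sub.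
- exact: smallest_sigma_algebra.
- move=> _ [e [A [mA ->]]]; apply: sub_sigma_algebra.
  exists (fun e' => if e' == e then A else setT).
    by move=> e'; case: ifP.
  apply/seteqP; split=> Q /=; last by move=> /(_ e); rewrite eqxx.
  by move=> AQ e'; case: eqP => [->|].
- exact: (@sigma_algebra_measurable _ config).
- by move=> _ [A mA ->]; exact: measurable_box.
Qed.

Lemma umul_inverse g : exists h, forall q, umul h (umul g q) = q /\ umul g (umul h q) = q.
Proof.
have hU : ((umx g)^t*)%sesqui \in @unitary_set R N.
  by apply/mem_set; rewrite /unitary_set /= trmxC_unitary; exact: umxP.
exists (SigSub hU) => q; split; apply: umx_inj.
  rewrite -[LHS]/((umx g)^t* *m (umx g *m umx q))%sesqui mulmxA.
  by rewrite -invmx_unitary ?umxP// mulVmx ?mul1mx// unitarymx_unit ?umxP.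
rewrite -[LHS]/(umx g *m ((umx g)^t* *m umx q))%sesqui mulmxA.
by rewrite -invmx_unitary ?umxP// mulmxV ?mul1mx// unitarymx_unit ?umxP.
Qed.

Variables (haar : probability BU R) (nu : probability config R).
Hypotheses (haarP : is_haar haar) (nuP : is_product_measure haar nu).

(** Haar invariance is given for direct images; preimages under [umul g] are
direct images under the inverse. *)
Lemma haar_preimage g (A : set BU) : measurable A -> haar (umul g @^-1` A) = haar A.
Proof.
move=> mA; have [h hK] := umul_inverse g.
rewrite -[RHS](haarP h mA); congr (haar _); apply/seteqP; split=> q /=.
  by exists (umul g q) => //; have [] := hK q.
by case=> q' Aq' <-; have [_ ->] := hK q'.
Qed.

(** A translation maps boxes to boxes and changes only the side at [x], whose
Haar measure is preserved; boxes determine the measure. *)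
Lemma translate_measure x g (B : set config) : measurable B ->
  nu (translate x g @^-1` B) = nu B.
Proof.
move=> mB; have mt := measurable_translate x g.
have := @measure_unique _ R _ _ (fun=> setT) measurable_configE _ _ _
  (pushforward nu (translate x g)) nu _ _ _ mB.
apply=> //.
- move=> _ _ [A mA ->] [A' mA' ->]; exists (fun e => A e `&` A' e).
    by move=> e; exact: measurableI.
  by apply/seteqP; split=> Q /= h; [move: h => [h h'] e; split|split=> e; have [] := h e].
- move=> _; exists (fun=> setT) => //.
  by apply/seteqP; split.
- by rewrite bigcup_const//; exists 0%N.
- move=> _ [A mA ->]; rewrite [RHS](nuP mA).
  pose A' e : set BU := if e == x then umul g @^-1` (A e) else A e.
  have mA' e : measurable (A' e).
    rewrite /A'; case: (e == x) => //.
    by rewrite -[X in measurable X]setTI; exact: measurable_umul.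
  transitivity (nu (box A')).
    congr (nu _); apply/seteqP; split=> Q h e; have := h e; rewrite /A' /translate;
      by case: (e == x).
  rewrite [LHS](nuP mA'); apply: eq_bigr => e _; rewrite /A'.
  by case: (e == x) => //; exact: haar_preimage.
- move=> _; apply: (@le_lt_trans _ _ (nu setT)); last by rewrite probability_setT ltry.
  by rewrite -[leRHS]/(nu (translate x g @^-1` setT)).
Qed.

Lemma observable_translate x g (F : config -> R[i]) : observable F ->
  observable (fun Q => F (translate x g Q)).
Proof.
move=> [[K FK] rF iF]; split; first by exists K.
- exact: measurableT_comp rF (measurable_translate x g).
- exact: measurableT_comp iF (measurable_translate x g).
Qed.

Lemma cintegral_translate x g (F : config -> R[i]) : observable F ->
  cintegral nu (fun Q => F (translate x g Q)) = cintegral nu F.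
Proof.
move=> oF; have [rF iF] := observable_integrable nu (observable_translate x g oF).
have mt := measurable_translate x g.
have transfer (f : config -> R) : measurable_fun setT f ->
    nu.-integrable setT (EFin \o (fun Q => f (translate x g Q))) ->
    \int[nu]_Q f (translate x g Q) = \int[nu]_Q f Q.
  move=> mf fi; rewrite /Rintegral; congr fine.
  have mEf : measurable_fun setT (EFin \o f) by exact/measurable_EFinP.
  rewrite -[LHS](integral_pushforward mt mEf (D := setT))//.
  by apply: eq_measure_integral => A mA _; exact: translate_measure.
case: oF => _ mr mi; rewrite /cintegral.
by congr (_ +i* _); [exact: transfer mr rF|exact: transfer mi iF].
Qed.

End EdgeTranslation.

(** * Words, insertions and one-parameter rotations *)

Section Words.
Variables (R : realType) (N : nat) (L : graph).
Local Notation C := R[i].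
Local Notation config := (config R N L).
Implicit Types (Q : config) (x e : oedge L) (u v w : seq (oedge L)) (X Y : 'M[C]_N).

Lemma positions_cat x u v : positions x (u ++ v) =
  positions x u ++ [seq size u + k | k <- positions x v]%N.
Proof.
rewrite /positions size_cat iotaD filter_cat; congr (_ ++ _).
  apply: eq_in_filter => k; rewrite mem_iota add0n => /andP[_ ku].
  by rewrite onth_cat ku.
rewrite add0n -[X in iota X]addn0 iotaDl filter_map; congr map.
by apply: eq_filter => k /=; rewrite onth_cat ltnNge leq_addr /= addKn.
Qed.

Lemma mem_positions x w k : (k \in positions x w) = (onth w k == Some x).
Proof.
rewrite mem_filter mem_iota add0n /=; case: (ltnP k (size w)) => kw.
  by rewrite andbT.
by rewrite andbF; apply/esym/negP => /eqP; rewrite onth_default.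
Qed.

Lemma onth_split w k x : onth w k = Some x ->
  (k < size w)%N /\ w = take k w ++ x :: drop k.+1 w.
Proof.
move=> wk; have kw : (k < size w)%N.
  by rewrite ltnNge; apply/negP => wk'; move: wk; rewrite onth_default.
split=> //; rewrite -[LHS](cat_take_drop k) (drop_nth x kw); congr (_ ++ _ :: _).
by move: wk; rewrite onthE (nth_map x)// => -[].
Qed.

Lemma edge_mxV Q x : edge_mx Q x *m edge_mx Q (einv x) = 1%:M.
Proof.
have uQ : umx (Q x.1) \in unitmx by apply/unitarymx_unit/umxP.
by case: x uQ => x [] uQ; rewrite /edge_mx /= ?mulmxV ?mulVmx.
Qed.

Lemma path_mx_nil Q : path_mx Q [::] = 1%:M.
Proof. by rewrite /path_mx big_nil. Qed.

Lemma path_mx_cons Q x w : path_mx Q (x :: w) = edge_mx Q x *m path_mx Q w.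
Proof. by rewrite /path_mx big_cons. Qed.

Lemma path_mx_cat Q u v : path_mx Q (u ++ v) = path_mx Q u *m path_mx Q v.
Proof.
elim: u => [|x u IH]; first by rewrite path_mx_nil mul1mx.
by rewrite cat_cons !path_mx_cons IH mulmxA.
Qed.

Lemma path_mx1 Q x : path_mx Q [:: x] = edge_mx Q x.
Proof. by rewrite path_mx_cons path_mx_nil mulmx1. Qed.

Definition insert X Q w c : 'M[C]_N :=
  path_mx Q (take c w) *m X *m path_mx Q (drop c w).

(** The derivative of the holonomy of [w] when the matrix of [e] moves in the
direction [X]: [X *m edge_mx Q e] if [e] is positively oriented, and
[edge_mx Q e *m X] if it is reversed, which decides on which side of each
letter [X] is inserted. *)
Definition dpath_sum e X Q w : 'M[C]_N :=
  \sum_(k <- positions e w) insert X Q w (k + ~~ e.2)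
  - \sum_(k <- positions (einv e) w) insert X Q w (k + e.2).

(* Locked: unification must not compare two derivatives by unfolding them. *)
Fact dpath_key : unit. Proof. exact: tt. Qed.

Definition dpath := locked_with dpath_key dpath_sum.

Lemma dpathE e X Q w : dpath e X Q w =
  \sum_(k <- positions e w) insert X Q w (k + ~~ e.2)
  - \sum_(k <- positions (einv e) w) insert X Q w (k + e.2).
Proof. by rewrite /dpath unlock. Qed.

Lemma insert_catl X Q u v c : (c <= size u)%N ->
  insert X Q (u ++ v) c = insert X Q u c *m path_mx Q v.
Proof.
move=> cu; rewrite /insert take_cat drop_cat; case: ltnP => [cu'|uc].
  by rewrite path_mx_cat !mulmxA.
have -> : c = size u by apply/eqP; rewrite eqn_leq cu.
by rewrite subnn take0 drop0 cats0 take_size drop_size path_mx_nil mulmx1.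
Qed.

Lemma insert_catr X Q u v c :
  insert X Q (u ++ v) (size u + c) = path_mx Q u *m insert X Q v c.
Proof.
rewrite /insert take_cat drop_cat ltnNge leq_addr /= addKn path_mx_cat.
by rewrite !mulmxA.
Qed.

Lemma cut_le x w k (b : bool) : k \in positions x w -> (k + b <= size w)%N.
Proof.
by rewrite mem_positions => /eqP/onth_split[kw _]; case: b; lia.
Qed.

(** Leibniz rule for a concatenation. *)
Lemma dpath_cat e X Q u v :
  dpath e X Q (u ++ v) = dpath e X Q u *m path_mx Q v + path_mx Q u *m dpath e X Q v.
Proof.
have part x (b : bool) : \sum_(k <- positions x (u ++ v)) insert X Q (u ++ v) (k + b)%N =
    (\sum_(k <- positions x u) insert X Q u (k + b)) *m path_mx Q v +
    path_mx Q u *m \sum_(k <- positions x v) insert X Q v (k + b).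
  rewrite positions_cat big_cat big_map /= mulmx_suml mulmx_sumr; congr (_ + _).
    by apply: eq_big_seq => k ku; rewrite insert_catl ?(cut_le _ ku).
  by apply: eq_bigr => k _; rewrite -addnA insert_catr.
rewrite !dpathE !part mulmxBl mulmxBr opprD addrACA.
by [].
Qed.

Lemma dpath1 e X Q x : dpath e X Q [:: x] =
  (if x == e then if e.2 then X *m edge_mx Q x else edge_mx Q x *m X else 0)
  - (if x == einv e then if e.2 then edge_mx Q x *m X else X *m edge_mx Q x else 0).
Proof.
have pos1 y : positions y [:: x] = if x == y then [:: 0%N] else [::].
  by rewrite /positions /=.
rewrite dpathE !pos1 /insert.
by case: (x == e); case: (x == einv e); rewrite ?big_nil ?big_seq1;
  case: e.2; rewrite /= ?path_mx1 ?path_mx_nil ?mul1mx ?mulmx1.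
Qed.

Lemma dpath_linear e Q w (z : C) X Y :
  dpath e (z *: X + Y) Q w = z *: dpath e X Q w + dpath e Y Q w.
Proof.
have ins c : insert (z *: X + Y) Q w c = z *: insert X Q w c + insert Y Q w c.
  by rewrite /insert mulmxDr mulmxDl -scalemxAr -scalemxAl.
rewrite !dpathE; under eq_bigr do rewrite ins.
under [X in _ - X]eq_bigr do rewrite ins.
by rewrite !big_split /= -!scaler_sumr scalerBr opprD addrACA.
Qed.

End Words.


Section Rotations.
Variables (R : realType) (N : nat) (L : graph).
Local Notation C := R[i].
Local Notation config := (config R N L).
Local Open Scope sesquilinear_scope.

(** The chord from 1 to the point [(1 + i t) / (1 - i t)] of the unit circle,
a rational parametrization of velocity [2 i] at [t = 0]. *)
Definition chord (t : R) : C :=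
  (- (2 * t ^+ 2) / (1 + t ^+ 2)) +i* (2 * t / (1 + t ^+ 2)).

Lemma conj_chord t : Num.conj (chord t) = chord (- t).
Proof.
rewrite -[LHS]/(conjc _) /chord /=; congr (_ +i* _); first by rewrite sqrrN.
by rewrite sqrrN mulrN mulNr.
Qed.

(** This says that [1 + chord t] has modulus one. *)
Lemma chord_unit t : chord t + chord (- t) + chord t * chord (- t) = 0.
Proof.
have D0 : 1 + t ^+ 2 != 0 by rewrite gt_eqF// ltr_pwDl// sqr_ge0.
rewrite /chord sqrrN; simpc; apply/eqP; rewrite eq_complex /=.
by apply/andP; split; apply/eqP; field.
Qed.

Lemma chord_taylor t : normc (chord t - t%:C * (0 +i* 2)) <= 4 * t ^+ 2.
Proof.
have s0 := sqr_ge0 t.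
have D0 : 0 < 1 + t ^+ 2 by lra.
have -> : chord t - t%:C * (0 +i* 2) =
    (- 2 * t ^+ 2 / (1 + t ^+ 2)) +i* (t ^+ 2 * (- 2 * (t / (1 + t ^+ 2)))).
  rewrite /chord; simpc; congr (_ +i* _); by field; rewrite gt_eqF.
apply: le_trans (normc_ReIm _ _) _.
have b1 : `|- 2 * t ^+ 2 / (1 + t ^+ 2)| <= 2 * t ^+ 2.
  rewrite normrM normfV (gtr0_norm D0) normrM normrN (ger0_norm (ler0n _ 2)).
  rewrite (ger0_norm s0).
  rewrite ler_pdivrMr//; have := mulr_ge0 s0 s0; lra.
have b2 : `|t / (1 + t ^+ 2)| <= 1.
  rewrite normrM normfV (gtr0_norm D0) ler_pdivrMr// mul1r.
  rewrite -(real_normK (num_real t)).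
  by have := sqr_ge0 (`|t| - 1); have := sqr_ge0 (`|t|); lra.
have b3 : `|t ^+ 2 * (- 2 * (t / (1 + t ^+ 2)))| <= t ^+ 2 * 2.
  rewrite normrM (ger0_norm s0) ler_wpM2l// normrM normrN (ger0_norm (ler0n _ 2)).
  lra.
by apply: le_trans (lerD b1 b3) _; lra.
Qed.

Variable P : 'M[C]_N.

Definition rotation_mx t : 'M[C]_N := 1%:M + chord t *: P.

Definition hermitian_projection := P *m P = P /\ P ^t* = P.
Hypothesis projP : hermitian_projection.

Lemma rotation_mx_adj t : (rotation_mx t) ^t* = rotation_mx (- t).
Proof.
have [_ PH] := projP; apply/matrixP => a b; rewrite !mxE.
have -> : P a b = Num.conj (P b a) by rewrite -[in LHS]PH !mxE.
by rewrite rmorphD rmorphM -conj_chord rmorph_nat eq_sym.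
Qed.

Lemma rotation_mxK t : rotation_mx t *m rotation_mx (- t) = 1%:M.
Proof.
have [PP _] := projP; rewrite /rotation_mx mulmxDl mul1mx mulmxDr mulmx1.
rewrite -scalemxAl -scalemxAr PP scalerA -addrA -!scalerDl.
rewrite [X in _ + X *: P](_ : _ = 0) ?scale0r ?addr0//.
by rewrite -[RHS](chord_unit t); ring.
Qed.

Lemma rotation_subproof t : rotation_mx t \in @unitary_set R N.
Proof.
by apply/mem_set/unitarymxP; rewrite rotation_mx_adj rotation_mxK.
Qed.

Definition rotation t : unitary R N := SigSub (rotation_subproof t).

Lemma invmx_rotation t : invmx (umx (rotation t)) = rotation_mx (- t).
Proof. by rewrite invmx_unitary ?umxP// -rotation_mx_adj. Qed.

(** For a reversed [e] the time is reversed as well, so that the matrix of [e] is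
always multiplied by [rotation_mx t], on the left or on the right. *)
Definition flow (e : oedge L) t : config -> config :=
  translate e.1 (rotation (if e.2 then t else - t)).

Lemma edge_mx_translate x g (Q : config) y :
  edge_mx (translate y g Q) x =
    if x.1 == y then
      if x.2 then umx g *m edge_mx Q x else edge_mx Q x *m invmx (umx g)
    else edge_mx Q x.
Proof.
rewrite /edge_mx /translate; case: (x.1 == y) => //; case: x.2 => //.
by rewrite !invmx_unitary ?umxP// -[umx (umul _ _)]/(umx g *m umx _)
  trmx_mul map_mxM.
Qed.

End Rotations.

(** * Derivatives of holonomies *)

Section PathDerivative.
Variables (R : realType) (N : nat) (L : graph).
Local Notation C := R[i].
Local Notation config := (config R N L).
Implicit Types (Q : config) (x e : oedge L) (w : seq (oedge L)) (X : 'M[C]_N).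
Implicit Types (a b : 'I_N).

Lemma edge_mx_unitary Q x : edge_mx Q x \is unitarymx.
Proof.
rewrite /edge_mx; case: x.2; first exact: umxP.
by rewrite invmx_unitary ?trmxC_unitary umxP.
Qed.

Lemma observable_edge_mx x a b : observable (fun Q => edge_mx Q x a b).
Proof.
have entry (c d : 'I_N) (f : C -> R) : continuous f ->
    measurable_fun setT (fun Q : config => f (umx (Q x.1) c d)).
  move=> cf.
  have mf : measurable_fun setT (fun q : borel_unitary R N => f (umx q c d)).
    apply: measurable_continuous => q.
    apply: (@continuous_comp _ _ _ (fun q => umx q c d) f); last exact: cf.
    exact: umx_entry_continuous.
  exact: measurableT_comp mf (measurable_coord x.1).
have mRe c d := entry c d _ (@Re_continuous R).
have mIm c d := entry c d _ (@Im_continuous R).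
split; first by exists 1 => Q; apply: normc_unitarymx; exact: edge_mx_unitary.
all: rewrite /edge_mx; case: x.2 => //.
all: have adj Q : invmx (umx (Q x.1)) a b = conjc (umx (Q x.1) b a)
  by rewrite invmx_unitary ?umxP// !mxE.
- rewrite (_ : (fun Q => _) = fun Q => complex.Re (umx (Q x.1) b a)) //.
  by apply/funext => Q; rewrite adj; case: (umx _ b a).
- rewrite (_ : (fun Q => _) = fun Q => - complex.Im (umx (Q x.1) b a)) //.
    exact: measurable_funN.
  by apply/funext => Q; rewrite adj; case: (umx _ b a).
Qed.

Lemma observable_mulmx (A B : config -> 'M[C]_N) :
  (forall a b, observable (fun Q => A Q a b)) ->
  (forall a b, observable (fun Q => B Q a b)) ->
  forall a b, observable (fun Q => (A Q *m B Q) a b).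
Proof.
move=> oA oB a b.
apply: eq_observable (observable_sum _ (fun k _ => observableM (oA a k) (oB k b))).
by move=> Q; rewrite mxE.
Qed.

Lemma observable_path_mx w a b : observable (fun Q => path_mx Q w a b).
Proof.
elim: w a b => [|x w IH] a b.
  apply: (@eq_observable _ _ _ (fun=> (1%:M : 'M[C]_N) a b)) => [Q|].
    by rewrite path_mx_nil.
  exact: observable_cst.
apply: (@eq_observable _ _ _ (fun Q => (edge_mx Q x *m path_mx Q w) a b)) => [Q|].
  by rewrite path_mx_cons.
by apply: observable_mulmx => // c d; exact: observable_edge_mx.
Qed.

Lemma observable_mxtrace (A : config -> 'M[C]_N) :
  (forall a b, observable (fun Q => A Q a b)) -> observable (fun Q => \tr (A Q)).
Proof. by move=> oA; apply: observable_sum. Qed.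

Lemma observable_dpath e X w a b : observable (fun Q => dpath e X Q w a b).
Proof.
have oi c (a' b' : 'I_N) : observable (fun Q => insert X Q w c a' b').
  apply: observable_mulmx => [c' d'|]; last exact: observable_path_mx.
  apply: observable_mulmx => c'' d''; first exact: observable_path_mx.
  exact: observable_cst.
apply: (@eq_observable _ _ _
  (fun Q => \sum_(k <- positions e w) insert X Q w (k + ~~ e.2) a b
    - \sum_(k <- positions (einv e) w) insert X Q w (k + e.2) a b)).
  by move=> Q; rewrite dpathE !mxE !summxE.
by apply: observableD; [|apply: observableN]; apply: observable_sum.
Qed.

Variable P : 'M[C]_N.
Hypothesis projP : hermitian_projection P.
Variable e : oedge L.
Local Notation flow := (flow projP e).
Local Notation X := ((0 +i* 2) *: P).

Lemma jet_mulmx (A A1 B B1 : config -> 'M[C]_N) :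
  (forall a b, jet flow (fun Q => A Q a b) (fun Q => A1 Q a b)) ->
  (forall a b, jet flow (fun Q => B Q a b) (fun Q => B1 Q a b)) ->
  forall a b, jet flow (fun Q => (A Q *m B Q) a b)
    (fun Q => (A1 Q *m B Q + A Q *m B1 Q) a b).
Proof.
move=> jA jB a b.
apply: eq_jet (jet_sum (index_enum _) xpredT (fun k => jetM (jA a k) (jB k b))) => Q.
  by rewrite mxE.
by rewrite !mxE -big_split.
Qed.

(** The only nonlinear dependence on time is through [chord], at time [t] or
[- t]; the factor [z] is [2 i] or [- 2 i] accordingly. *)
Lemma jet_chord (F W : config -> C) (z : C) (u : R -> R) K :
  (forall t, `|u t| = `|t|) -> (forall t, (u t)%:C * (0 +i* 2) = t%:C * z) ->
  (forall t Q, F (flow t Q) = F Q + chord (u t) * W Q) ->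
  (forall Q, normc (F Q) <= K) -> (forall Q, normc (W Q) <= K) ->
  jet flow F (fun Q => z * W Q).
Proof.
move=> un uz FW FK WK.
exists (`|K| + normc z * `|K| + 4 * `|K|) => [|t Q t1].
  by rewrite !addr_ge0 ?mulr_ge0 ?normc_ge0.
have K0 := normr_ge0 K; have KK := ler_norm K; have z0 := normc_ge0 z.
have zK0 : 0 <= normc z * `|K| by exact: mulr_ge0.
have WK' := le_trans (WK Q) KK; have FK' := le_trans (FK Q) KK.
split; first lra.
  by rewrite normcM; apply: (@le_trans _ _ (normc z * `|K|)); [exact: ler_wpM2l|lra].
rewrite FW (_ : _ - _ = (chord (u t) - (u t)%:C * (0 +i* 2)) * W Q); last first.
  by rewrite uz; ring.
rewrite normcM; apply: (@le_trans _ _ (4 * (u t) ^+ 2 * `|K|)).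
  by rewrite ler_pM ?normc_ge0//; exact: chord_taylor.
rewrite -[(u t) ^+ 2]real_normK ?num_real// un real_normK ?num_real//.
have t0 := sqr_ge0 t; have := mulr_ge0 (addr_ge0 K0 zK0) t0; lra.
Qed.

Lemma normc_mulmx_unitary (A M : 'M[C]_N) a b : M \is unitarymx ->
  normc ((A *m M) a b) <= \sum_i \sum_j normc (A i j) /\
  normc ((M *m A) a b) <= \sum_i \sum_j normc (A i j).
Proof.
move=> uM; have nsum (f : 'I_N -> C) : normc (\sum_i f i) <= \sum_i normc (f i).
  elim/big_rec2 : _ => [|i y z _ yz]; first by rewrite normc0.
  by apply: le_trans (normcD _ _) _; rewrite lerD2l.
have A0 i j : 0 <= normc (A i j) by exact: normc_ge0.
split; rewrite mxE; apply: le_trans (nsum _) _.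
  rewrite [leRHS](bigD1 a)//= -[leLHS]addr0; apply: lerD.
    apply: ler_sum => k _; rewrite normcM -[leRHS]mulr1 ler_wpM2l//.
    exact: normc_unitarymx.
  by apply: sumr_ge0 => i _; apply: sumr_ge0.
rewrite [leRHS]exchange_big [leRHS](bigD1 b)//= -[leLHS]addr0; apply: lerD.
  apply: ler_sum => k _; rewrite normcM -[leRHS]mul1r ler_wpM2r//.
  exact: normc_unitarymx.
by apply: sumr_ge0 => i _; apply: sumr_ge0.
Qed.

Lemma jet_edge_mx x a b :
  jet flow (fun Q => edge_mx Q x a b) (fun Q => dpath e X Q [:: x] a b).
Proof.
have uE Q := edge_mx_unitary Q x.
pose K := 1 + \sum_i \sum_j normc (P i j).
have S0 : 0 <= \sum_i \sum_j normc (P i j).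
  by apply: sumr_ge0 => i _; apply: sumr_ge0 => j _; exact: normc_ge0.
have K0 : 0 <= K by rewrite /K; lra.
have EK Q : normc (edge_mx Q x a b) <= K.
  by apply: le_trans (normc_unitarymx _ _ (uE Q)) _; rewrite lerDl.
have PEK Q : normc ((P *m edge_mx Q x) a b) <= K.
  by apply: le_trans (proj1 (normc_mulmx_unitary P a b (uE Q))) _; rewrite lerDr.
have EPK Q : normc ((edge_mx Q x *m P) a b) <= K.
  by apply: le_trans (proj2 (normc_mulmx_unitary P a b (uE Q))) _; rewrite lerDr.
have [xe|xe] := eqVneq x.1 e.1; last first.
  have [ne ni] : (x == e) = false /\ (x == einv e) = false.
    by split; apply/negP => /eqP xE; move: xe; rewrite xE eqxx.
  exists K => [//|t Q _].
  rewrite dpath1 ne ni subrr mxE mulr0 subr0 normc0; split=> //.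
  rewrite /flow edge_mx_translate (negbTE xe) subrr normc0.
  by rewrite mulr_ge0 ?sqr_ge0.
have eqx : (x == e) = (x.2 == e.2) /\ (x == einv e) = (x.2 == ~~ e.2).
  by move: xe; case: (x) => x1 x2; case: (e) => e1 e2 /= ->; rewrite !xpair_eqE !eqxx.
case: eqx => xE xI.
pose u (t : R) := if x.2 == e.2 then t else - t.
have un t : `|u t| = `|t| by rewrite /u; case: ifP => // _; rewrite normrN.
pose z : C := if x.2 == e.2 then 0 +i* 2 else - (0 +i* 2).
have uz t : (u t)%:C * (0 +i* 2) = t%:C * z.
  by rewrite /u /z; case: ifP => // _; rewrite raddfN /= mulNr mulrN.
pose W Q := if x.2 then P *m edge_mx Q x else edge_mx Q x *m P.
have flowE t Q : edge_mx (flow t Q) x a b = edge_mx Q x a b + chord (u t) * W Q a b.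
  rewrite /flow edge_mx_translate xe eqxx invmx_rotation /W /u.
  by case: x.2; case: e.2 => /=; rewrite ?opprK /rotation_mx
    ?mulmxDl ?mulmxDr ?mul1mx ?mulmx1 -?scalemxAl -?scalemxAr !mxE.
have WK Q : normc (W Q a b) <= K by rewrite /W; case: x.2.
apply: eq_jet (jet_chord un uz flowE EK WK) => Q //.
rewrite dpath1 xE xI /z /W.
by case: x.2; case: e.2 => /=; rewrite ?subr0 ?sub0r -?scalemxAl -?scalemxAr !mxE ?mulNr.
Qed.

Lemma jet_path_mx w a b :
  jet flow (fun Q => path_mx Q w a b) (fun Q => dpath e X Q w a b).
Proof.
elim: w a b => [|x w IH] a b.
  apply: eq_jet (jet_cst flow ((1%:M : 'M[C]_N) a b)) => Q.
    by rewrite path_mx_nil.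
  by rewrite dpathE !big_nil subrr mxE.
apply: eq_jet (jet_mulmx (jet_edge_mx x) IH a b) => Q.
  by rewrite path_mx_cons.
by rewrite -path_mx1 -dpath_cat.
Qed.

End PathDerivative.

(** * Hermitian projections span all matrices *)

Section Polarization.
Variables (R : realType) (N : nat).
Local Notation C := R[i].
Local Open Scope sesquilinear_scope.
Variable I : 'M[C]_N -> C.
Hypothesis I_linear : forall z X Y, I (z *: X + Y) = z * I X + I Y.
Hypothesis I_projection : forall P, hermitian_projection P -> I P = 0.

Let I0 : I 0 = 0.
Proof.
have := I_linear 1 0 0; rewrite scale1r addr0 mul1r -[LHS]addr0.
by move/addrI => <-.
Qed.

Let IZ z X : I (z *: X) = z * I X.
Proof. by have := I_linear z X 0; rewrite addr0 I0 addr0. Qed.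

Let ID X Y : I (X + Y) = I X + I Y.
Proof. by have := I_linear 1 X Y; rewrite scale1r mul1r. Qed.

(** Divided by [n.+1], the matrix [v v^*] is the projection on the line of
[v]. *)
Lemma rank_one_vanish (v : 'cV[C]_N) (n : nat) :
  v ^t* *m v = (n.+1%:R)%:M -> I (v *m v ^t*) = 0.
Proof.
move=> vv; have n0 : n.+1%:R != 0 :> C by rewrite pnatr_eq0.
have : I (n.+1%:R^-1 *: (v *m v ^t*)) = 0.
  apply: I_projection; split.
    rewrite -scalemxAl -scalemxAr mulmxA -(mulmxA v) vv mul_mx_scalar.
    by rewrite -scalemxAl scalerK.
  rewrite linearZ /= map_mxZ /= fmorphV rmorph_nat trmx_mul map_mxM.
  by rewrite trmxCK.
by rewrite IZ => /eqP; rewrite mulf_eq0 invr_eq0 (negbTE n0) => /eqP.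
Qed.

(** Polarization: with [v = e_a + w e_b] and [w = 1] or [w = i], the matrices
[v v^*] give two independent equations for the values of [I] at the two
off-diagonal elementary matrices. *)
Lemma delta_vanish a b : I (delta_mx a b) = 0.
Proof.
have diag c : I (delta_mx c c) = 0.
  have := @rank_one_vanish (delta_mx c 0) 0.
  rewrite trmx_delta map_delta_mx !mul_delta_mx; apply.
  by apply/matrixP => i j; rewrite !ord1 !mxE.
have [->|ab] := eqVneq a b; first exact: diag.
have off (w : C) : w * Num.conj w = 1 ->
    Num.conj w * I (delta_mx a b) + w * I (delta_mx b a) = 0.
  move=> ww; pose v : 'cV[C]_N := delta_mx a 0 + w *: delta_mx b 0.
  have vt : v ^t* = delta_mx 0 a + Num.conj w *: delta_mx 0 b.
    by rewrite /v linearD /= linearZ /= !trmx_delta map_mxD map_mxZ !map_delta_mx.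
  have := @rank_one_vanish v 1; rewrite vt /v.
  rewrite !mulmxDl !mulmxDr -!scalemxAl -!scalemxAr !mul_delta_mx.
  rewrite !mul_delta_mx_0 // 1?eq_sym // !scaler0 !addr0 !add0r scalerA mulrC ww.
  rewrite scale1r !ID !IZ !diag; move=> h; rewrite -[RHS]h ?mulr0 ?add0r ?addr0//.
  by apply/matrixP => i j; rewrite !ord1 !mxE.
have ci : Num.conj ('i%C : C) = - 'i%C.
  by rewrite -[LHS]/(conjc _) /=; simpc.
have ii : 'i%C * 'i%C = -1 :> C by rewrite -expr2 sqr_i.
have := off 1; rewrite conjC1 !mul1r => /(_ erefl) h1.
have := off 'i%C; rewrite ci mulrN ii opprK => /(_ erefl) h2.
have yE : I (delta_mx b a) = - I (delta_mx a b).
  by apply/eqP; rewrite -addr_eq0 addrC h1.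
move: h2; rewrite yE mulrN mulNr -opprD => /eqP; rewrite oppr_eq0 -mulr2n.
rewrite mulrn_eq0 /= mulf_eq0 => /orP[/eqP i0|/eqP//].
by move: ii; rewrite i0 mul0r => /esym/eqP; rewrite oppr_eq0 oner_eq0.
Qed.


End Polarization.

(** * Vanishing of the integrated derivative *)

Section SchwingerDyson.
Variables (R : realType) (N : nat) (L : graph).
Local Notation C := R[i].
Local Notation config := (config R N L).
Variables (haar : probability (borel_unitary R N) R) (nu : probability config R).
Hypotheses (haarP : is_haar haar) (nuP : is_product_measure haar nu).
Variables (beta : R) (P : seq (seq (oedge L))) (e : oedge L).
Implicit Types (Q : config) (w : seq (oedge L)) (X : 'M[C]_N) (a b : 'I_N).

Definition ntrace w Q : C := N%:R^-1 * \tr (path_mx Q w).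

Definition dntrace X w Q : C := N%:R^-1 * \tr (dpath e X Q w).

Definition daction X Q : C :=
  \sum_(p <- P) N%:R * beta%:C * \tr (dpath e X Q p).

(** As a single exponential, the density needs only one application of
[jet_cexp]. *)
Lemma density_cexp Q :
  density beta P Q = cexp (\sum_(p <- P) N%:R * beta%:C * \tr (path_mx Q p)).
Proof.
rewrite /density; elim: P => [|p P' IH]; last by rewrite !big_cons IH cexpD.
by rewrite !big_nil /cexp /= expR0 cos0 sin0 !mul1r.
Qed.

Lemma observable_ntrace w : observable (ntrace w).
Proof.
apply: observableM; first exact: observable_cst.
by apply: observable_mxtrace; exact: observable_path_mx.
Qed.

Lemma observable_density : observable (density beta P : config -> C).
Proof.
apply: observable_prod => p _; apply: observable_cexp.
apply: observableM; first exact: observable_cst.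
by apply: observable_mxtrace; exact: observable_path_mx.
Qed.

Lemma observable_wilson s : observable (fun Q => wilson s Q * density beta P Q).
Proof.
apply: observableM; last exact: observable_density.
by apply: observable_prod => w _; exact: observable_ntrace.
Qed.

Variables (rs : seq nat) (ws : nat -> seq (oedge L)) (m : seq (oedge L)).
Hypothesis rs_uniq : uniq rs.

(** The derivative of the product of the normalized traces of the [ws r]. *)
Definition dwords X Q : C :=
  \sum_(r <- rs) dntrace X (ws r) Q * \prod_(k <- rs | k != r) ntrace (ws k) Q.

Definition drest X Q : C :=
  dwords X Q * density beta P Q
  + (\prod_(r <- rs) ntrace (ws r) Q) * (density beta P Q * daction X Q).

(** The derivative, in the direction [X], of the [(a, b)] entry of the holonomy
of [m] times the remaining Wilson loops and the density. *)
Definition dentry X a b Q : C :=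
  dpath e X Q m a b * (\prod_(r <- rs) ntrace (ws r) Q * density beta P Q)
  + path_mx Q m a b * drest X Q.

Lemma dpath_trace_linear (z : C) X Y Q w :
  \tr (dpath e (z *: X + Y) Q w) = z * \tr (dpath e X Q w) + \tr (dpath e Y Q w).
Proof. by rewrite dpath_linear linearD linearZ. Qed.

Lemma daction_linear (z : C) X Y Q :
  daction (z *: X + Y) Q = z * daction X Q + daction Y Q.
Proof.
rewrite /daction mulr_sumr -big_split; apply: eq_bigr => p _ /=.
rewrite dpath_trace_linear.
by move: (\tr (dpath e X Q p)) (\tr (dpath e Y Q p)) => x y; rewrite mulrDr mulrCA.
Qed.

Lemma dwords_linear (z : C) X Y Q :
  dwords (z *: X + Y) Q = z * dwords X Q + dwords Y Q.
Proof.
rewrite /dwords mulr_sumr -big_split; apply: eq_bigr => r _ /=.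
rewrite /dntrace dpath_trace_linear; move: (\prod_(k <- rs | _) _) => q.
move: (\tr (dpath e X Q _)) (\tr (dpath e Y Q _)) => x y.
by rewrite mulrDr mulrDl mulrCA -!mulrA.
Qed.

Lemma dentry_linear (z : C) X Y a b Q :
  dentry (z *: X + Y) a b Q = z * dentry X a b Q + dentry Y a b Q.
Proof.
have dE : dpath e (z *: X + Y) Q m a b = z * dpath e X Q m a b + dpath e Y Q m a b.
  by rewrite dpath_linear !mxE.
rewrite /dentry /drest dE daction_linear dwords_linear.
move: (dpath e X Q m a b) (dpath e Y Q m a b) (dwords X Q) (dwords Y Q).
move: (daction X Q) (daction Y Q) (density beta P Q) (path_mx Q m a b).
move: (\prod_(r <- rs) _) => p a1 a2 D q d1 d2 g1 g2.
by ring.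
Qed.

Lemma observable_dentry X a b : observable (dentry X a b).
Proof.
have otr w : observable (fun Q : config => \tr (dpath e X Q w)).
  by apply: observable_mxtrace; exact: observable_dpath.
have ocst z : observable (fun _ : config => z) by exact: observable_cst.
have oprod (p : pred nat) : observable (fun Q => \prod_(r <- rs | p r) ntrace (ws r) Q).
  by apply: observable_prod => r _; exact: observable_ntrace.
have odens := observable_density.
apply: observableD; apply: observableM.
- exact: observable_dpath.
- exact: observableM.
- exact: observable_path_mx.
apply: observableD; apply: observableM => //.
  apply: observable_sum => r _; apply: observableM => //.
  by apply: observableM.
apply: observableM => //; apply: observable_sum => p _.
by apply: observableM.
Qed.

Lemma jet_dentry (A : 'M[C]_N) (projA : hermitian_projection A) a b :
  jet (flow projA e)
    (fun Q => path_mx Q m a b * (\prod_(r <- rs) ntrace (ws r) Q * density beta P Q))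
    (dentry ((0 +i* 2) *: A) a b).
Proof.
have jtr w : jet (flow projA e) (fun Q => \tr (path_mx Q w))
    (fun Q => \tr (dpath e ((0 +i* 2) *: A) Q w)).
  by apply: jet_sum => c; exact: jet_path_mx.
apply: jetM; first exact: jet_path_mx.
apply: jetM; first by apply: jet_prod => // r; exact: jetMl.
apply: eq_jet (jet_cexp (jet_sum P xpredT (fun p => jetMl _ (jtr p)))) => Q.
  by rewrite density_cexp.
by rewrite density_cexp.
Qed.

(** [cintegral_jet] gives the claim for [X = 2 i A] with [A] a hermitian
projection; the integral is linear in [X], and projections span. *)
Lemma schwinger_dyson X a b : cintegral nu (dentry X a b) = 0.
Proof.
pose I X := cintegral nu (dentry X a b).
have IL z Y Z : I (z *: Y + Z) = z * I Y + I Z.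
  rewrite /I -cintegralZ; last exact: observable_dentry.
  rewrite -cintegralD; last exact: observable_dentry.
    by apply: eq_cintegral => Q; exact: dentry_linear.
  by apply: observableM; [exact: observable_cst|exact: observable_dentry].
have I0 : I 0 = 0.
  have := IL 1 0 0; rewrite scale1r addr0 mul1r -[LHS]addr0.
  by move/addrI => <-.
have Iproj A : hermitian_projection A -> I A = 0.
  move=> pA; have z0 : (0 +i* 2 : C) != 0 by rewrite eq_complex /= pnatr_eq0 andbF.
  have := IL (0 +i* 2) A 0; rewrite addr0 I0 addr0.
  rewrite {1}/I (@cintegral_jet _ _ _ nu (flow pA e) _ _ _ _ _ (jet_dentry pA a b)).
  - by move/esym/eqP; rewrite mulf_eq0 (negbTE z0) => /eqP.
  - move=> t F oF; split; first exact: observable_translate.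
    exact: (cintegral_translate haarP nuP).
  - apply: observableM; first exact: observable_path_mx.
    apply: observableM; last exact: observable_density.
    by apply: observable_prod => r _; exact: observable_ntrace.
  - exact: observable_dentry.
rewrite -/(I X) (matrix_sum_delta X).
have Isum (T : Type) (r : seq T) (F : T -> 'M[C]_N) :
    (forall i, I (F i) = 0) -> I (\sum_(i <- r) F i) = 0.
  move=> F0; elim: r => [|i r IH]; first by rewrite big_nil.
  by have := IL 1 (F i) (\sum_(i <- r) F i); rewrite scale1r big_cons => ->;
    rewrite F0 IH mulr0 addr0.
apply: (Isum) => i; apply: Isum => j.
have := IL (X i j) (delta_mx i j) 0; rewrite addr0 => ->.
by rewrite I0 (delta_vanish IL Iproj) mulr0 addr0.
Qed.

End SchwingerDyson.

(** * Index contractions and cuts of words *)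

Section Cuts.
Variables (R : realType) (N : nat) (L : graph).
Local Notation C := R[i].
Local Notation config := (config R N L).
Implicit Types (Q : config) (x y e : oedge L) (u v w l : seq (oedge L)).

Lemma mxtrace_path_rot Q u v : \tr (path_mx Q (u ++ v)) = \tr (path_mx Q (v ++ u)).
Proof. by rewrite !path_mx_cat mxtrace_mulC. Qed.

(** Cutting the closed word [l] at [c] and [c'] leaves two closed words: the
arc between the cuts and the arc through the base point. *)
Definition cut_traces Q l c c' : C :=
  \tr (path_mx Q (drop (minn c c') (take (maxn c c') l)))
  * \tr (path_mx Q (take (minn c c') l ++ drop (maxn c c') l)).

Lemma cut_tracesC Q l c c' : cut_traces Q l c c' = cut_traces Q l c' c.
Proof. by rewrite /cut_traces minnC maxnC. Qed.

Lemma cut_traces_cat Q u v w :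
  cut_traces Q (u ++ v ++ w) (size u) (size u + size v) =
  \tr (path_mx Q v) * \tr (path_mx Q (u ++ w)).
Proof.
rewrite /cut_traces (minn_idPl (leq_addr _ _)) (maxn_idPr (leq_addr _ _)).
rewrite catA -size_cat take_size_cat// drop_size_cat// drop_size_cat//.
by rewrite -catA take_size_cat.
Qed.

(** The empty arc is the null loop, of trace [N]; this is the source of the
left-hand side of the loop equation. *)
Lemma cut_traces_refl Q l c : cut_traces Q l c c = N%:R * \tr (path_mx Q l).
Proof.
rewrite /cut_traces minnn maxnn cat_take_drop drop_oversize ?size_take_min ?geq_minl//.
by rewrite path_mx_nil mxtrace1.
Qed.

(** [\sum_(a, b) (A E_ab B)_ab = tr A * tr B]: contraction splits a trace. *)
Lemma sum_insert_delta Q w c :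
  \sum_a \sum_b insert (delta_mx a b) Q w c a b =
  \tr (path_mx Q (take c w)) * \tr (path_mx Q (drop c w)).
Proof.
rewrite [X in X * _]/mxtrace mulr_suml; apply: eq_bigr => a _.
rewrite /mxtrace mulr_sumr; apply: eq_bigr => b _.
rewrite /insert mxE (bigD1 b)//= mxE (bigD1 a)//= !mxE !eqxx /= mulr1.
rewrite big1 => [|k /negbTE ka]; last by rewrite mxE ka mulr0.
rewrite addr0 big1 ?addr0// => k /negbTE kb.
by rewrite mxE big1 ?mul0r// => k' _; rewrite mxE kb andbF mulr0.
Qed.

(** [\sum_(a, b) M_ab * tr (A E_ab B) = tr (M B A)]: contraction merges two
traces. *)
Lemma sum_trace_insert_delta (M : 'M[C]_N) Q w c :
  \sum_a \sum_b M a b * \tr (insert (delta_mx a b) Q w c) =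
  \tr (M *m path_mx Q (drop c w ++ take c w)).
Proof.
rewrite /mxtrace; apply: eq_bigr => a _; rewrite mxE; apply: eq_bigr => b _.
congr (_ * _); rewrite -[LHS]/(\tr _) /insert -mulmxA mxtrace_mulC -mulmxA.
rewrite -path_mx_cat [LHS](bigD1 a)//= mxE (bigD1 b)//= mxE !eqxx mul1r.
rewrite !big1 ?addr0// => k /negbTE ka; last by rewrite mxE ka andbF mul0r.
by rewrite mxE big1// => k' _; rewrite mxE ka mul0r.
Qed.

(** Starting the word [u ++ v] at its second half turns every letter of the
loop into a pair of cuts, the first of which is at [size u]. *)
Lemma sum_dpath_delta e Q u v :
  \sum_a \sum_b dpath e (delta_mx a b) Q (v ++ u) a b =
    \sum_(k <- positions e (u ++ v)) cut_traces Q (u ++ v) (size u) (k + ~~ e.2)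
  - \sum_(k <- positions (einv e) (u ++ v)) cut_traces Q (u ++ v) (size u) (k + e.2).
Proof.
have part x (d : bool) :
    \sum_a \sum_b \sum_(k <- positions x (v ++ u))
      insert (delta_mx a b) Q (v ++ u) (k + d) a b =
    \sum_(k <- positions x (u ++ v)) cut_traces Q (u ++ v) (size u) (k + d).
  under eq_bigr do rewrite exchange_big.
  rewrite exchange_big; under eq_bigr do rewrite sum_insert_delta.
  rewrite !positions_cat !big_cat !big_map [RHS]addrC /=; congr (_ + _).
    apply: eq_big_seq => k /(cut_le d) kv; set c := (k + d)%N in kv *.
    rewrite -addnA -/c.
    have -> : u ++ v = u ++ take c v ++ drop c v by rewrite cat_take_drop.
    rewrite -[X in (_ + X)%N](size_takel kv) cut_traces_cat; congr (_ * _).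
      by rewrite takel_cat.
    by rewrite drop_cat [RHS]mxtrace_path_rot; case: ltngtP kv => // -> _;
      rewrite subnn drop0 drop_size.
  apply: eq_big_seq => k /(cut_le d) ku; set c := (k + d)%N in ku *.
  rewrite -addnA -/c take_cat drop_cat ltnNge leq_addr /= addKn.
  rewrite cut_tracesC; have -> : u ++ v = take c u ++ drop c u ++ v.
    by rewrite catA cat_take_drop.
  rewrite -[X in _ = cut_traces _ _ X _](size_takel ku).
  have -> : size u = (size (take c u) + size (drop c u))%N.
    by rewrite -size_cat cat_take_drop.
  by rewrite cut_traces_cat mulrC mxtrace_path_rot.
under eq_bigr => a _ do under eq_bigr => b _ do rewrite dpathE !mxE !summxE.
rewrite -!part -sumrB; apply: eq_bigr => a _; exact: sumrB.
Qed.

Lemma sum_trace_dpath_delta (M : 'M[C]_N) e Q w :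
  \sum_a \sum_b M a b * \tr (dpath e (delta_mx a b) Q w) =
    \sum_(k <- positions e w)
      \tr (M *m path_mx Q (drop (k + ~~ e.2) w ++ take (k + ~~ e.2) w))
  - \sum_(k <- positions (einv e) w)
      \tr (M *m path_mx Q (drop (k + e.2) w ++ take (k + e.2) w)).
Proof.
have part x (d : bool) :
    \sum_a \sum_b \sum_(k <- positions x w)
      M a b * \tr (insert (delta_mx a b) Q w (k + d)) =
    \sum_(k <- positions x w) \tr (M *m path_mx Q (drop (k + d) w ++ take (k + d) w)).
  under eq_bigr do rewrite exchange_big.
  rewrite exchange_big; apply: eq_bigr => k _; exact: sum_trace_insert_delta.
rewrite -!part -sumrB; apply: eq_bigr => a _; rewrite -sumrB; apply: eq_bigr => b _.
have trs r (F : nat -> 'M[C]_N) :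
    M a b * \tr (\sum_(k <- r) F k) = \sum_(k <- r) M a b * \tr (F k).
  by rewrite (linear_sum (mxtrace (n:=N))) mulr_sumr.
by rewrite -!trs dpathE linearB mulrBr.
Qed.

Lemma take_cut l j x (d : bool) : onth l j = Some x ->
  take (j + d) l = take j l ++ nseq d x.
Proof.
move=> /onth_split[jl lE]; case: d; rewrite ?addn0 ?cats0//= addn1.
have sz : size (take j l) = j by rewrite size_takel// ltnW.
by rewrite {1}lE take_cat sz ltnNge leqnSn /= subSnn /= take0.
Qed.

Lemma drop_cut l j x (d : bool) : onth l j = Some x ->
  drop (j + d) l = nseq (~~ d) x ++ drop j.+1 l.
Proof.
move=> /onth_split[jl lE]; case: d; rewrite ?addn1// addn0 {1}lE.
by rewrite drop_size_cat// size_takel// ltnW.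
Qed.

Lemma two_letters l a b x y : (a < b)%N -> onth l a = Some x -> onth l b = Some y ->
  l = before a l ++ x :: between a b l ++ y :: after b l.
Proof.
move=> ab la /onth_split[bl lE].
have lta : onth (take b l) a = Some x by rewrite -la {2}lE onth_cat size_takel ?ab// ltnW.
have [_ tE] := onth_split lta.
rewrite [LHS]lE {1}tE /before /between /after -catA /=.
by rewrite -[in X in _ = X ++ _](take_takel l (ltnW ab)).
Qed.

Lemma cut_traces_letters Q l a b x y (d d' : bool) :
  (a < b)%N -> onth l a = Some x -> onth l b = Some y ->
  cut_traces Q l (a + d) (b + d') =
  \tr (path_mx Q (nseq (~~ d) x ++ between a b l ++ nseq d' y))
  * \tr (path_mx Q (before a l ++ nseq d x ++ nseq (~~ d') y ++ after b l)).
Proof.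
move=> ab la lb.
have al : (a < size l)%N by have [] := onth_split la.
have bl : (b < size l)%N by have [] := onth_split lb.
have lE : l = (before a l ++ nseq d x) ++
    (nseq (~~ d) x ++ between a b l ++ nseq d' y) ++ (nseq (~~ d') y ++ after b l).
  rewrite [LHS](two_letters ab la lb).
  by case: (d); case: (d'); rewrite /= ?cats0 -?catA.
have sd : size (before a l ++ nseq d x) = (a + d)%N.
  by rewrite size_cat size_nseq size_takel// ltnW.
have sd' : size (between a b l) = (b - a.+1)%N.
  by rewrite size_drop size_takel// ltnW.
rewrite [in LHS]lE -sd (_ : (b + d' = size (before a l ++ nseq d x) +
  size (nseq (~~ d) x ++ between a b l ++ nseq d' y))%N).
  by rewrite cut_traces_cat -!catA.
by rewrite sd !size_cat !size_nseq sd'; case: (d); case: (d'); lia.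
Qed.

Lemma path_mx_edgeV Q u v x (d : bool) :
  path_mx Q (u ++ nseq d x ++ nseq d (einv x) ++ v) = path_mx Q (u ++ v).
Proof.
case: d => //=; rewrite !path_mx_cat !path_mx_cons.
by rewrite (mulmxA (edge_mx Q x)) edge_mxV mul1mx.
Qed.

Lemma einvK x : einv (einv x) = x.
Proof. by case: x => x []. Qed.

Lemma path_mx_edgeVK Q u v x (d : bool) :
  path_mx Q (u ++ nseq d (einv x) ++ nseq d x ++ v) = path_mx Q (u ++ v).
Proof. by rewrite -{2}(einvK x) path_mx_edgeV. Qed.

(** The two cuts are on the same side of their letters [e], so each arc keeps
exactly one of them. *)
Lemma cut_traces_split_pos Q l e j k : onth l j = Some e -> onth l k = Some e ->
  k != j ->
  cut_traces Q l (j + ~~ e.2) (k + ~~ e.2) =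
  \tr (path_mx Q (before (minn j k) l ++ e :: after (maxn j k) l))
  * \tr (path_mx Q (rcons (between (minn j k) (maxn j k) l) e)).
Proof.
wlog jk : j k / (j < k)%N.
  move=> h lj lk kj; have [kj'|jk] := orP (etrans (esym (neq_ltn k j)) kj).
    by rewrite cut_tracesC minnC maxnC (h k j)// eq_sym.
  exact: (h j k).
move=> lj lk _; rewrite (minn_idPl (ltnW jk)) (maxn_idPr (ltnW jk)).
rewrite (cut_traces_letters _ _ _ jk lj lk) mulrC; congr (_ * _).
  by case: e.2.
rewrite -cats1; case: e.2 => /=; first by rewrite cats0 -cat1s mxtrace_path_rot.
by [].
Qed.

(** The two cuts are on opposite sides of [e] and [einv e], so both letters
belong to the same arc, in which they are cyclically adjacent and cancel. *)
Lemma cut_traces_split_neg Q l e j k : onth l j = Some e ->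
  onth l k = Some (einv e) ->
  cut_traces Q l (j + ~~ e.2) (k + e.2) =
  \tr (path_mx Q (before (minn j k) l ++ after (maxn j k) l))
  * \tr (path_mx Q (between (minn j k) (maxn j k) l)).
Proof.
have rotV x v (d : bool) :
    \tr (path_mx Q (nseq d x ++ v ++ nseq d (einv x))) = \tr (path_mx Q v).
  rewrite catA mxtrace_path_rot -[nseq d _ ++ _]/([::] ++ _) path_mx_edgeVK.
  by [].
move=> lj lk; have [jk|kj|ejk] := ltngtP j k.
- rewrite (cut_traces_letters _ _ _ jk lj lk) mulrC.
  congr (_ * _).
    by rewrite path_mx_edgeV.
  by rewrite negbK rotV.
- rewrite cut_tracesC (cut_traces_letters _ _ _ kj lk lj) mulrC; congr (_ * _).
    by rewrite negbK path_mx_edgeVK.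
  by have := rotV (einv e) (between k j l) (~~ e.2); rewrite einvK.
- move: lk; rewrite -ejk lj => -[] /(congr1 snd) /= /eqP.
  by rewrite eq_sym; case: e.2.
Qed.

(** Both words are opened on the same side of their letter [e], so the glued
word contains both letters. *)
Lemma trace_merge_pos Q l w e j k : onth l j = Some e -> onth w k = Some e ->
  \tr (path_mx Q (drop (j + ~~ e.2) l ++ take (j + ~~ e.2) l) *m
       path_mx Q (drop (k + ~~ e.2) w ++ take (k + ~~ e.2) w)) =
  \tr (path_mx Q (before j l ++ e :: after k w ++ before k w ++ e :: after j l)).
Proof.
move=> lj wk; rewrite -path_mx_cat -catA [LHS]mxtrace_path_rot.
rewrite !(take_cut _ lj) !(drop_cut _ lj) !(take_cut _ wk) !(drop_cut _ wk).
by rewrite -!catA; case: e.2.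
Qed.

(** The words are opened on opposite sides of [e] and [einv e], which become
adjacent after gluing and cancel. *)
Lemma trace_merge_neg Q l w e j k : onth l j = Some e -> onth w k = Some (einv e) ->
  \tr (path_mx Q (drop (j + ~~ e.2) l ++ take (j + ~~ e.2) l) *m
       path_mx Q (drop (k + e.2) w ++ take (k + e.2) w)) =
  \tr (path_mx Q (before j l ++ after k w ++ before k w ++ after j l)).
Proof.
move=> lj wk; rewrite -path_mx_cat -catA [LHS]mxtrace_path_rot.
rewrite !(take_cut _ lj) !(drop_cut _ lj) !(take_cut _ wk) !(drop_cut _ wk) negbK.
rewrite -!catA path_mx_edgeV catA catA path_mx_edgeVK.
by rewrite -!catA.
Qed.

End Cuts.

(** * Loop equation *)

Section LoopEquation.
Variables (R : realType) (N : nat) (L : graph).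
Local Notation C := R[i].
Local Notation config := (config R N L).
Hypothesis N_ge1 : (1 <= N)%N.
Implicit Types (Q : config) (s : seq (seq (oedge L))) (w : seq (oedge L)).

Definition other_loops s i : seq nat := [seq r <- iota 0 (size s) | r != i].

Lemma map_other_loops s i : (i < size s)%N ->
  [seq loop_at s r | r <- other_loops s i] = take i s ++ drop i.+1 s.
Proof.
move=> si; have -> : other_loops s i = iota 0 i ++ iota i.+1 (size s - i.+1).
  rewrite /other_loops -{1}(subnKC si) addSnnS iotaD filter_cat add0n /= eqxx /=.
  by congr (_ ++ _); apply/all_filterP/allP => r; rewrite mem_iota; lia.
rewrite map_cat map_nth_iota0 1?ltnW// map_nth_iota//.
by rewrite -size_drop take_size.
Qed.

Lemma wilson_ntrace s Q : wilson s Q = \prod_(w <- s) ntrace w Q.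
Proof. by []. Qed.

Lemma wilson_replace s i new Q : (i < size s)%N ->
  wilson (replace s i new) Q =
  \prod_(w <- new) ntrace w Q * \prod_(r <- other_loops s i) ntrace (loop_at s r) Q.
Proof.
move=> si; rewrite -(big_map (loop_at s) xpredT (fun w => ntrace w Q)).
by rewrite map_other_loops// wilson_ntrace !big_cat /= mulrCA.
Qed.

Lemma wilson_loop_at s i Q : (i < size s)%N ->
  wilson s Q =
  ntrace (loop_at s i) Q * \prod_(r <- other_loops s i) ntrace (loop_at s r) Q.
Proof.
move=> si; rewrite -(big_seq1 *%R _ (fun w => ntrace w Q)) -wilson_replace//.
congr (wilson _ Q).
by rewrite /replace /loop_at /= -(drop_nth [::] si) cat_take_drop.
Qed.

Lemma wilson_replace2 s i r w Q : (i < size s)%N -> r != i ->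
  wilson (replace2 s i r w) Q =
  ntrace w Q * \prod_(k <- other_loops s i | k != r) ntrace (loop_at s k) Q.
Proof.
move=> si ri; rewrite wilson_ntrace big_map (bigD1_seq i) /=; first last.
- by rewrite filter_uniq// iota_uniq.
- by rewrite mem_filter eq_sym ri mem_iota add0n.
rewrite eqxx !big_filter_cond; congr (_ * _); apply: eq_big => [k|k /andP[_]].
  by rewrite andbC.
by move=> /negbTE ->.
Qed.

Variables (beta : R) (P s : seq (seq (oedge L))) (i j : nat) (e : oedge L).
Hypothesis e_at_ij : edge_at s i j = Some e.

Local Notation l := (loop_at s i).
Local Notation c := (j + ~~ e.2)%N.
Local Notation rest Q := (\prod_(r <- other_loops s i) ntrace (loop_at s r) Q).

Let si : (i < size s)%N.
Proof.
rewrite ltnNge; apply/negP => si; move: e_at_ij.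
by rewrite /edge_at /loop_at nth_default// onth_default.
Qed.

Let N0 : N%:R != 0 :> C.
Proof. by rewrite pnatr_eq0 -lt0n. Qed.

Let posP x w k : k \in positions x w -> onth w k = Some x.
Proof. by rewrite mem_positions => /eqP. Qed.

Let NN (x : C) : N%:R * (N%:R^-1 * x) = x.
Proof. by rewrite mulVKf. Qed.

Lemma trace_ntrace w Q : \tr (path_mx Q w) = N%:R * ntrace w Q.
Proof. by rewrite /ntrace NN. Qed.

Let scale_pair (K : comNzRingType) (n x y z : K) :
  n * x * (n * y) * z = n ^+ 2 * (x * y * z).
Proof. by ring. Qed.

(** The position [j] itself contributes the Wilson loop of [s], by
[cut_traces_refl]. *)
Lemma sum_split Q :
  (\sum_a \sum_b dpath e (delta_mx a b) Q (drop c l ++ take c l) a b) * rest Q =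
  N%:R ^+ 2 * (wilson s Q + \sum_(s' <- split_pos e s i j) wilson s' Q
                          - \sum_(s' <- split_neg e s i j) wilson s' Q).
Proof.
have sz : size (take c l) = c.
  by rewrite size_takel// (cut_le (~~ e.2) (x := e))// mem_positions; apply/eqP.
rewrite sum_dpath_delta cat_take_drop sz.
rewrite (bigD1_seq j) /=; last by rewrite filter_uniq// iota_uniq.
  rewrite cut_traces_refl trace_ntrace mulrBl mulrDl mulrBr mulrDr.
  congr (_ + _ - _).
  - by rewrite (wilson_loop_at _ si) expr2 -!mulrA.
  - rewrite /split_pos [in RHS]big_map [in RHS]big_filter mulr_suml mulr_sumr.
    rewrite big_seq_cond [RHS]big_seq_cond; apply: eq_bigr => k /andP[/posP lk kj].
    rewrite cut_traces_split_pos// wilson_replace// big_cons big_seq1 !trace_ntrace.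
    exact: scale_pair.
  - rewrite /split_neg [in RHS]big_map mulr_suml mulr_sumr.
    apply: eq_big_seq => k /posP lk.
    rewrite cut_traces_split_neg// wilson_replace// big_cons big_seq1 !trace_ntrace.
    exact: scale_pair.
by rewrite mem_positions; apply/eqP.
Qed.

Lemma sum_merge Q :
  \sum_a \sum_b path_mx Q (drop c l ++ take c l) a b *
    dwords e (other_loops s i) (loop_at s) (delta_mx a b) Q =
  \sum_(s' <- merge_pos e s i j) wilson s' Q
  - \sum_(s' <- merge_neg e s i j) wilson s' Q.
Proof.
rewrite /merge_pos /merge_neg !big_allpairs_dep -sumrB -/(other_loops s i).
under eq_bigr => a _ do under eq_bigr => b _ do rewrite /dwords mulr_sumr.
under eq_bigr do rewrite exchange_big.
rewrite exchange_big; apply: eq_big_seq => r.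
rewrite mem_filter => /andP[ri _] /=.
set q := \prod_(k <- _ | _) _.
transitivity (N%:R^-1 * q * \sum_a \sum_b path_mx Q (drop c l ++ take c l) a b *
    \tr (dpath e (delta_mx a b) Q (loop_at s r))).
  rewrite mulr_sumr; apply: eq_bigr => a _; rewrite mulr_sumr; apply: eq_bigr => b _.
  rewrite /dntrace; move: (\tr _) (path_mx _ _ a b) => x y.
  by rewrite mulrCA -!mulrA; congr (_ * _); rewrite mulrCA [x * q]mulrC mulrCA.
rewrite sum_trace_dpath_delta mulrBr !mulr_sumr; congr (_ - _).
  apply: eq_big_seq => k /posP wk.
  rewrite path_mx_cat -path_mx_cat trace_merge_pos// wilson_replace2//.
  by rewrite /ntrace mulrAC.
apply: eq_big_seq => k /posP wk.
by rewrite trace_merge_neg// wilson_replace2// /ntrace mulrAC.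
Qed.

Lemma sum_deform Q :
  rest Q * (\sum_a \sum_b path_mx Q (drop c l ++ take c l) a b *
    daction beta P e (delta_mx a b) Q) =
  N%:R ^+ 2 * (beta%:C * (\sum_(s' <- deform_pos P e s i j) wilson s' Q)
               - beta%:C * (\sum_(s' <- deform_neg P e s i j) wilson s' Q)).
Proof.
have -> : \sum_a \sum_b path_mx Q (drop c l ++ take c l) a b *
      daction beta P e (delta_mx a b) Q =
    \sum_(p <- P) N%:R * beta%:C * \sum_a \sum_b
      path_mx Q (drop c l ++ take c l) a b * \tr (dpath e (delta_mx a b) Q p).
  under eq_bigr => a _ do under eq_bigr => b _ do rewrite /daction mulr_sumr.
  under eq_bigr do rewrite exchange_big.
  rewrite exchange_big; apply: eq_bigr => p _ /=.
  rewrite mulr_sumr; apply: eq_bigr => a _; rewrite mulr_sumr; apply: eq_bigr => b _.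
  by rewrite mulrCA.
rewrite /deform_pos /deform_neg !big_allpairs_dep -mulrBr -sumrB mulrA.
rewrite [LHS]mulr_sumr [RHS]mulr_sumr; apply: eq_bigr => p _ /=.
have scale (x : C) : rest Q * (N%:R * beta%:C) * (N%:R * x) =
    N%:R ^+ 2 * beta%:C * (x * rest Q).
  move: (rest Q) (beta%:C) (N%:R : C) => z b n.
  by ring.
rewrite sum_trace_dpath_delta mulrA !mulrBr; congr (_ - _).
  rewrite [LHS]mulr_sumr [RHS]mulr_sumr; apply: eq_big_seq => k /posP wk.
  by rewrite trace_merge_pos// wilson_replace// big_seq1 trace_ntrace scale.
rewrite [LHS]mulr_sumr [RHS]mulr_sumr.
apply: eq_big_seq => k /posP wk.
by rewrite trace_merge_neg// wilson_replace// big_seq1 trace_ntrace scale.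
Qed.

Lemma sum_dentry Q :
  \sum_a \sum_b dentry beta P e (other_loops s i) (loop_at s)
    (drop c l ++ take c l) (delta_mx a b) a b Q =
  N%:R ^+ 2 * (wilson s Q + \sum_(s' <- split_pos e s i j) wilson s' Q
               - \sum_(s' <- split_neg e s i j) wilson s' Q
    + (N%:R ^+ 2)^-1 * (\sum_(s' <- merge_pos e s i j) wilson s' Q
               - \sum_(s' <- merge_neg e s i j) wilson s' Q)
    + (beta%:C * (\sum_(s' <- deform_pos P e s i j) wilson s' Q)
               - beta%:C * (\sum_(s' <- deform_neg P e s i j) wilson s' Q)))
  * density beta P Q.
Proof.
rewrite 2!mulrDr mulVKf ?expf_neq0// 2!mulrDl -sum_split -sum_merge -sum_deform.
rewrite !mulr_suml !mulr_sumr !mulr_suml -!big_split; apply: eq_bigr => a _ /=.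
rewrite !mulr_suml !mulr_sumr !mulr_suml -!big_split; apply: eq_bigr => b _ /=.
rewrite /dentry /drest.
move: (density _ _ _) (dwords _ _ _ _ _) (daction _ _ _ _ _) => D x y.
move: (path_mx _ _ a b) (dpath _ _ _ _ a b) (rest Q) => p d z.
by ring.
Qed.

End LoopEquation.

Theorem theorem5p7 (R : realType) (N : nat) (N_ge1 : (1 <= N)%N) (L : graph)
  (P : seq (seq (oedge L))) (plaqP : plaquette_set P)
  (beta : R) (beta_gt0 : 0 < beta)
  (haar : probability (borel_unitary R N) R) (haarP : is_haar haar)
  (nu : probability (config R N L) R) (nuP : is_product_measure haar nu)
  (s : seq (seq (oedge L))) (loops_s : all (@is_loop L) s)
  (i j : nat) (e : oedge L) (e_at_ij : edge_at s i j = Some e) :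
  let phi := wilson_expectation nu beta P in
  phi s =
    - (\sum_(s' <- split_pos e s i j) phi s')
    + \sum_(s' <- split_neg e s i j) phi s'
    - (N%:R ^+ 2)^-1 * (\sum_(s' <- merge_pos e s i j) phi s')
    + (N%:R ^+ 2)^-1 * (\sum_(s' <- merge_neg e s i j) phi s')
    - beta%:C * (\sum_(s' <- deform_pos P e s i j) phi s')
    + beta%:C * (\sum_(s' <- deform_neg P e s i j) phi s').
Proof.
move=> phi; set Z := cintegral nu (density beta P).
pose W s' (Q : config R N L) := wilson s' Q * density beta P Q.
have oW s' : observable (W s') by exact: observable_wilson.
pose J s' := cintegral nu (W s').
pose SW (r : seq (seq (seq (oedge L)))) Q := \sum_(s' <- r) W s' Q.
pose SJ (r : seq (seq (seq (oedge L)))) := \sum_(s' <- r) J s'.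
have oSW r : observable (SW r) by apply: observable_sum => s' _.
have SWJ r : cintegral nu (SW r) = SJ r by exact: cintegral_sum.
have phiE r : \sum_(s' <- r) phi s' = Z^-1 * SJ r by rewrite mulr_sumr.
have SWE r Q : SW r Q = (\sum_(s' <- r) wilson s' Q) * density beta P Q.
  by rewrite mulr_suml.
have N2 : N%:R ^+ 2 != 0 :> R[i] by rewrite expf_neq0// pnatr_eq0 -lt0n.
set n2 := (N%:R ^+ 2)^-1.
pose has_integral (F : config R N L -> R[i]) z := observable F /\ cintegral nu F = z.
have iW s' : has_integral (W s') (J s') by [].
have iSW r : has_integral (SW r) (SJ r) by [].
have iD F G x y : has_integral F x -> has_integral G y ->
    has_integral (fun Q => F Q + G Q) (x + y).
  by move=> [oF <-] [oG <-]; split; [exact: observableD|exact: cintegralD].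
have iZ z F x : has_integral F x -> has_integral (fun Q => z * F Q) (z * x).
  move=> [oF <-]; split; last exact: cintegralZ.
  by apply: observableM => //; exact: observable_cst.
have iB F G x y : has_integral F x -> has_integral G y ->
    has_integral (fun Q => F Q - G Q) (x - y).
  move=> [oF <-] [oG <-]; split; last exact: cintegralB.
  by apply: observableD => //; exact: observableN.
have pointwise Q : N%:R ^+ 2 * (W s Q
      + SW (split_pos e s i j) Q - SW (split_neg e s i j) Q
      + n2 * SW (merge_pos e s i j) Q - n2 * SW (merge_neg e s i j) Q
      + beta%:C * SW (deform_pos P e s i j) Q
      - beta%:C * SW (deform_neg P e s i j) Q) =
    \sum_a \sum_b dentry beta P e (other_loops s i) (loop_at s)
      (drop (j + ~~ e.2) (loop_at s i) ++ take (j + ~~ e.2) (loop_at s i))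
      (delta_mx a b) a b Q.
  rewrite (sum_dentry N_ge1 beta P e_at_ij) !SWE /W -/n2.
  by move: (N%:R ^+ 2) n2 (beta%:C) (density beta P Q) => n m b D; ring.
have uniq_others : uniq (other_loops s i) by rewrite filter_uniq// iota_uniq.
have : N%:R ^+ 2 * (J s + SJ (split_pos e s i j) - SJ (split_neg e s i j)
      + n2 * SJ (merge_pos e s i j) - n2 * SJ (merge_neg e s i j)
      + beta%:C * SJ (deform_pos P e s i j)
      - beta%:C * SJ (deform_neg P e s i j)) = 0.
  have [_ <-] := iZ (N%:R ^+ 2) _ _ (iB _ _ _ _ (iD _ _ _ _ (iB _ _ _ _ (iD _ _ _ _
    (iB _ _ _ _ (iD _ _ _ _ (iW s) (iSW (split_pos e s i j)))
      (iSW (split_neg e s i j)))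
      (iZ n2 _ _ (iSW (merge_pos e s i j)))) (iZ n2 _ _ (iSW (merge_neg e s i j))))
      (iZ beta%:C _ _ (iSW (deform_pos P e s i j))))
      (iZ beta%:C _ _ (iSW (deform_neg P e s i j)))).
  rewrite (eq_cintegral _ pointwise) cintegral_sum => [|a]; last first.
    by apply: observable_sum => b _; exact: observable_dentry.
  apply: big1 => a _; rewrite cintegral_sum => [|b]; last exact: observable_dentry.
  by apply: big1 => b _; exact: (schwinger_dyson haarP nuP).
move=> /eqP; rewrite mulf_eq0 (negbTE N2) /= => /eqP J0.
rewrite -[phi s]/(Z^-1 * J s) !phiE.
have -> : J s = - SJ (split_pos e s i j) + SJ (split_neg e s i j)
    - n2 * SJ (merge_pos e s i j) + n2 * SJ (merge_neg e s i j)
    - beta%:C * SJ (deform_pos P e s i j) + beta%:C * SJ (deform_neg P e s i j).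
  by apply/eqP; rewrite -subr_eq0 -[X in _ == X]J0; apply/eqP; ring.
move: (SJ (split_pos e s i j)) (SJ (split_neg e s i j)) => x1 x2.
move: (SJ (merge_pos e s i j)) (SJ (merge_neg e s i j)) => x3 x4.
move: (SJ (deform_pos P e s i j)) (SJ (deform_neg P e s i j)) => x5 x6.
by ring.
Qed.
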